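(* Let $\tilde P_n=\{\mathbf U_1,\dots,\mathbf U_n\}\subseteq[0,1)^s$, $n=b^m$, be a scrambled $(0,m,s)$-net in base $b$, and let $f\in L^2([0,1)^s)$ be a function whose base $b$ Walsh series decomposition satisfies $$\sigma_{\mathbf k}^2(f)=\left(\frac{b-1}{b}\right)^r(bx)^k\alpha_f\qquad\text{for all }\mathbf k\in\mathbb N^s,$$ where $\alpha_f$ is a positive constant that depends on $f$, $x\in[0,1/b)$, $k=k_1+\cdots+k_s$, and $r$ is the number of non-zero coordinates of $\mathbf k$. Then $$\mathrm{Cov}(f(\mathbf U_I),f(\mathbf U_J))\le0\quad\text{and}\quad\mathrm{Var}(\hat I_n(f))\le\mathrm{Var}(\hat I_{MC,n}(f)).$$
   Context: $\mathbb N=\{0,1,2,\dots\}$; $b$ is a prime, $s,m\ge1$ are integers, $n=b^m$. Nets. For $\mathbf k\in\mathbb N^s$, a set of $n=b^m$ points in $[0,1)^s$ is $\mathbf k$-equidistributed in base $b$ if every interval $\prod_{j=1}^s[a_jb^{-k_j},(a_j+1)b^{-k_j})$ with $a_j\in\{0,\dots,b^{k_j}-1\}$ contains exactly $b^{m-k_1-\cdots-k_s}$ of the points. It is a $(0,m,s)$-net in base $b$ if it is $\mathbf k$-equidistributed for all $\mathbf k\in\mathbb N^s$ with $k_1+\cdots+k_s\le m$. Common digits. For $x,y\in[0,1)$, $\gamma_b(x,y)$ is the number of initial common base $b$ digits of $x$ and $y$ (using finite expansions whenever possible), i.e. the $i$ with $\lfloor b^ix\rfloor=\lfloor b^iy\rfloor$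 and $\lfloor b^{i+1}x\rfloor\ne\lfloor b^{i+1}y\rfloor$ ($\infty$ if $x=y$). For $\mathbf i\in\mathbb N^s$, $D_{\mathbf i}^s=\{(\mathbf x,\mathbf y)\in[0,1)^{2s}:\gamma_b(x_j,y_j)=i_j,\ j=1,\dots,s\}$. Scrambling. A scrambled $(0,m,s)$-net in base $b$ is a random point set $\tilde P_n=\{\mathbf U_1,\dots,\mathbf U_n\}$ obtained from a $(0,m,s)$-net $\{\mathbf V_1,\dots,\mathbf V_n\}$ in base $b$ such that each $\mathbf U_l$ is uniformly distributed on $[0,1)^s$ and, for all $l\neq j$ and $\mathbf i\in\mathbb N^s$, if $(\mathbf V_l,\mathbf V_j)\in D_{\mathbf i}^s$ then $(\mathbf U_l,\mathbf U_j)$ is uniformly distributed in $D_{\mathbf i}^s$. Covariance and estimators. $\mathbf U_I,\mathbf U_J$ are two distinct randomly selected points of $\tilde P_n$: $(I,J)$ is a uniformly random ordered pair of distinct indices, independent of the scrambling. With $\psi$ the density of $(\mathbf U_I,\mathbf U_J)$ on $[0,1)^{2s}$, $$\mathrm{Cov}(f(\mathbf U_I),f(\mathbf U_J))=\int_{[0,1)^s}\int_{[0,1)^s}(\psi(\mathbf x,\mathbf y)-1)f(\mathbf x)\overline{f(\mathbf y)}\,d\mathbf x\,d\mathbf y.$$ $\hat I_n(f)=\frac1n\sum_{i=1}^nf(\mathbf U_i)$, and $\hat I_{MC,n}(f)$ is the Monte Carlo estimator $\frac1n\sum_{i=1}^nf(\mathbf X_i)$ with $\mathbf X_1,\dots,\mathbf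 X_n$ independent and uniform on $[0,1)^s$. For complex random variables $\mathrm{Var}(Z)=\mathbb E|Z-\mathbb EZ|^2$. Walsh functions. For $l\in\mathbb N$ with $l=\lambda_0+\lambda_1b+\lambda_2b^2+\cdots$ and $x\in[0,1)$ with $x=\xi_1b^{-1}+\xi_2b^{-2}+\cdots$ (finite expansion if possible), $\mathrm{wal}_l(x)=\omega_b^{\lambda_0\xi_1+\lambda_1\xi_2+\cdots}$ with $\omega_b=e^{2\pi i/b}$; $\mathrm{wal}_{\mathbf l}(\mathbf x)=\prod_{j=1}^s\mathrm{wal}_{l_j}(x_j)$. These form an orthonormal basis of $L^2([0,1)^s)$, and $\hat f(\mathbf l)=\int_{[0,1)^s}f(\mathbf x)\overline{\mathrm{wal}_{\mathbf l}(\mathbf x)}\,d\mathbf x$. For $\mathbf k\in\mathbb N^s$, $L_{\mathbf k}=\{\mathbf l\in\mathbb N^s:\lfloor b^{k_j-1}\rfloor\le l_j<b^{k_j},\ j=1,\dots,s\}$ and $\sigma_{\mathbf k}^2(f)=\sum_{\mathbf l\in L_{\mathbf k}}|\hat f(\mathbf l)|^2$. Convention: $0^0=1$. *)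

(* Defs.v *)
From HB Require Import structures.
From mathcomp Require Import all_boot all_order all_algebra.
From mathcomp Require Import complex.
From mathcomp Require Import all_classical all_reals all_analysis.

Set Implicit Arguments.
Unset Strict Implicit.
Unset Printing Implicit Defensive.

Import Order.TTheory GRing.Theory Num.Theory.
Import numFieldNormedType.Exports.
Import ComplexField.Normc.

Local Open Scope classical_set_scope.
Local Open Scope ring_scope.
Local Open Scope complex_scope.

(* Points of R^s are s-tuples, which carry the product Borel sigma-algebra.
   s-dimensional Lebesgue measure is built one coordinate at a time. The first
   factor is measurableTypeR R because lebesgue_measure lives on that display of
   the Borel sigma-algebra of R. *)

Section lebesgue_tuple_step.
Context (R : realType) (n : nat).
Variable mu : {sigma_finite_measure set (n.-tuple R) -> \bar R}.

Definition tuple_cons (p : measurableTypeR R * n.-tuple R) : n.+1.-tuple R :=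
  [tuple of (p.1 : R) :: p.2].

Lemma measurable_tuple_cons : measurable_fun setT tuple_cons.
Proof.
apply: measurable_cons; last exact: measurable_snd.
by move=> _ Y mY; apply: measurable_fst.
Qed.

Definition lebesgue_cons : set (n.+1.-tuple R) -> \bar R :=
  pushforward (@lebesgue_measure R \x mu)%E tuple_cons.

Let lebesgue_cons0 : lebesgue_cons set0 = 0%E.
Proof. by rewrite /lebesgue_cons /pushforward preimage_set0 measure0. Qed.

Let lebesgue_cons_ge0 A : (0 <= lebesgue_cons A)%E.
Proof. exact: (measure_ge0 (@lebesgue_measure R \x mu)%E). Qed.

Let lebesgue_cons_sigma_additive : semi_sigma_additive lebesgue_cons.
Proof.
move=> F mF tF mUF; rewrite /lebesgue_cons /pushforward preimage_bigcup.
apply: measure_semi_sigma_additive.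
- by move=> k; rewrite -[X in measurable X]setTI; exact: measurable_tuple_cons.
- apply/trivIsetP => /= i j _ _ ij; rewrite -preimage_setI.
  by move/trivIsetP : tF => /(_ _ _ _ _ ij) ->//; rewrite preimage_set0.
- rewrite -preimage_bigcup -[X in measurable X]setTI.
  exact: measurable_tuple_cons.
Qed.

HB.instance Definition _ := isMeasure.Build _ _ _ lebesgue_cons
  lebesgue_cons0 lebesgue_cons_ge0 lebesgue_cons_sigma_additive.

Let lebesgue_cons_sigma_finite : sigma_finite setT lebesgue_cons.
Proof.
have /sigma_finiteP[F [FT ndF Foo]] := sigma_finiteT (@lebesgue_measure R).
have /sigma_finiteP[G [GT ndG Goo]] := sigma_finiteT mu.
pose g (t : n.+1.-tuple R) : measurableTypeR R * n.-tuple R :=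
  (thead t, [tuple of behead t]).
have mg : measurable_fun setT g.
  apply: measurable_fun_pair; last exact: measurable_behead.
  by move=> _ Y mY; apply: (@measurable_tnth _ R _ ord0).
have gK p : g (tuple_cons p) = p.
  case: p => a t; rewrite /g /tuple_cons /=; congr (_, _).
  exact: val_inj.
exists (fun k => g @^-1` (F k `*` G k)).
  apply/esym; rewrite -subTset => t _.
  have : (\bigcup_i F i) (thead t) by rewrite -FT.
  have : (\bigcup_i G i) [tuple of behead t] by rewrite -GT.
  move=> [k _ Gk] [l _ Fl]; exists (maxn k l) => //; split=> /=.
  - by move: Fl; exact/subsetPset/ndF/leq_maxr.
  - by move: Gk; exact/subsetPset/ndG/leq_maxl.
move=> k; have [mF Fk] := Foo k; have [mG Gk] := Goo k; split.
  by rewrite -[X in measurable X]setTI; apply: mg => //; exact: measurableX.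
rewrite /lebesgue_cons /pushforward -comp_preimage.
rewrite (_ : g \o tuple_cons = id); last exact/funext.
by rewrite preimage_id product_measure1E// lte_mul_pinfty// ge0_fin_numE.
Qed.

HB.instance Definition _ := Measure_isSigmaFinite.Build _ _ _
  lebesgue_cons lebesgue_cons_sigma_finite.

End lebesgue_tuple_step.

Fixpoint lebesgue_tuple (R : realType) (s : nat) :
    {sigma_finite_measure set (s.-tuple R) -> \bar R} :=
  match s with
  | 0 => \d_([tuple] : 0.-tuple R)
  | s'.+1 => lebesgue_cons (lebesgue_tuple R s')
  end.

Lemma lebesgue_tuple_box (R : realType) (s : nat) (A : 'I_s -> set R) :
  (forall j, measurable (A j)) ->
  lebesgue_tuple R s [set t | forall j, A j (tnth t j)] =
  (\prod_(j < s) lebesgue_measure (A j))%E.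
Proof.
elim: s A => [|s IHs] A mA.
  rewrite big_ord0 /= diracE mem_set//= => -[[]//].
rewrite big_ord_recl /= -IHs// /lebesgue_cons /pushforward.
rewrite -product_measure1E//=; last first.
  rewrite (_ : [set t | _] =
      \big[setI/setT]_(j < s) [set t : s.-tuple R | A (lift ord0 j) (tnth t j)]).
    apply: bigsetI_measurable => j _; rewrite -[X in measurable X]setTI.
    exact: (@measurable_tnth _ R s j).
  rewrite -bigcap_seq; apply/seteqP; split=> t /= h j; first by move=> _; exact: h.
  by apply: (h j) => /=; rewrite mem_index_enum.
  exact: (mA ord0).
congr (_ _); apply/seteqP; split => [[a t] /= h|[a t] /= [ha ht] j].
  split; first by have := h ord0; rewrite tnth0.
  by move=> j; have := h (lift ord0 j); rewrite tnthS.
by case: (unliftP ord0 j) => [j'|] ->; rewrite ?tnthS ?tnth0.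
Qed.

Definition unit_cube (R : realType) (s : nat) : set (s.-tuple R) :=
  [set x | forall j, 0 <= tnth x j < 1].
Arguments unit_cube R s : clear implicits.

Definition elementary_interval (R : realType) (b s : nat)
    (k a : {ffun 'I_s -> nat}) : pred (s.-tuple R) :=
  fun x => [forall j : 'I_s,
    (a j)%:R / b%:R ^+ k j <= tnth x j < (a j).+1%:R / b%:R ^+ k j].

Definition equidistributed (R : realType) (b m s : nat)
    (k : {ffun 'I_s -> nat}) (V : 'I_(b ^ m) -> s.-tuple R) : Prop :=
  forall a : {ffun 'I_s -> nat}, (forall j, (a j < b ^ k j)%N) ->
    #|[pred l | elementary_interval b k a (V l)]|%:R
      = (b%:R : R) ^ (m%:Z - (\sum_j k j)%N%:Z).

Definition is_net (R : realType) (b m s : nat)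
    (V : 'I_(b ^ m) -> s.-tuple R) : Prop :=
  (forall l, unit_cube R s (V l)) /\
  forall k : {ffun 'I_s -> nat}, (\sum_j k j <= m)%N -> equidistributed k V.

(* For x, y in [0, 1): i is the number of initial common base b digits of x and
   y, finite expansions being used whenever possible. No i qualifies if x = y. *)
Definition common_digits (R : realType) (b : nat) (x y : R) (i : nat) : Prop :=
  Num.floor (b%:R ^+ i * x) = Num.floor (b%:R ^+ i * y) /\
  Num.floor (b%:R ^+ i.+1 * x) <> Num.floor (b%:R ^+ i.+1 * y).

Definition digit_set (R : realType) (b s : nat) (i : {ffun 'I_s -> nat}) :
    set (s.-tuple R * s.-tuple R) :=
  [set xy | [/\ unit_cube R s xy.1, unit_cube R s xy.2 &
    forall j, common_digits b (tnth xy.1 j) (tnth xy.2 j) (i j)]].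
Arguments digit_set R b {s} i.

Section random_points.
Context (R : realType) (d : measure_display) (Omega : measurableType d)
  (P : probability Omega R).

(* If mu D is 0 or +oo then fine (mu D) = 0 and no X satisfies this. *)
Definition uniform_on (d' : measure_display) (T : measurableType d')
    (mu : set T -> \bar R) (D : set T) (X : Omega -> T) : Prop :=
  forall A, measurable A ->
    P (X @^-1` A) = (fine (mu (A `&` D)) / fine (mu D))%:E.

Definition independent_points (n s : nat) (X : 'I_n -> Omega -> s.-tuple R) :
    Prop :=
  forall (J : {set 'I_n}) (A : 'I_n -> set (s.-tuple R)),
    (forall l, measurable (A l)) ->
    P [set w | forall l, l \in J -> A l (X l w)] =
    (\prod_(l in J) P (X l @^-1` A l))%E.

(* Values are required to lie in the cube surely, not only almost surely,
   because integrands are only assumed measurable on the cube. *)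
Definition uniform_cube (s : nat) (X : Omega -> s.-tuple R) : Prop :=
  (forall w, unit_cube R s (X w)) /\
  uniform_on (lebesgue_tuple R s) (unit_cube R s) X.

Definition monte_carlo_points (n s : nat)
    (X : 'I_n -> {RV P >-> s.-tuple R}) : Prop :=
  (forall l, uniform_cube (X l)) /\ independent_points (fun l => X l).

Definition scrambled_net (b m s : nat)
    (U : 'I_(b ^ m) -> {RV P >-> s.-tuple R}) : Prop :=
  exists2 V : 'I_(b ^ m) -> s.-tuple R, is_net V &
    (forall l, uniform_cube (U l)) /\
    (forall (l j : 'I_(b ^ m)) (i : {ffun 'I_s -> nat}), l != j ->
      digit_set R b i (V l, V j) ->
      uniform_on (lebesgue_tuple R s \x lebesgue_tuple R s)%E
        (digit_set R b i) (fun w => (U l w, U j w))).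

(* (I, J) is a uniformly random ordered pair of distinct indices, independent
   of the whole family U. *)
Definition random_distinct_indices (n s : nat)
    (U : 'I_n -> Omega -> s.-tuple R) (I J : Omega -> 'I_n) : Prop :=
  [/\ forall i j, measurable [set w | I w = i /\ J w = j],
      forall i j, P [set w | I w = i /\ J w = j] =
        (if i == j then 0 else (n * n.-1)%:R^-1)%:E &
      forall i j (B : set (n.-tuple (s.-tuple R))), measurable B ->
        P [set w | (I w = i /\ J w = j) /\ B [tuple U l w | l < n]] =
        (P [set w | I w = i /\ J w = j] *
         P [set w | B [tuple U l w | l < n]])%E].

Definition cexpectation (Z : Omega -> R[i]) : R[i] :=
  fine 'E_P[fun w => complex.Re (Z w)] +i* fine 'E_P[fun w => complex.Im (Z w)].

Definition cvariance (Z : Omega -> R[i]) : \bar R :=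
  'E_P[fun w => normc (Z w - cexpectation Z) ^+ 2].

(* In R[i], z <= 0 means that z is real and nonpositive. *)
Definition ccovariance (Y Z : Omega -> R[i]) : R[i] :=
  cexpectation (fun w =>
    (Y w - cexpectation Y) * conjc (Z w - cexpectation Z)).

End random_points.

Definition sample_mean (R : realType) (n s : nat) (Omega : Type)
    (f : s.-tuple R -> R[i]) (X : 'I_n -> Omega -> s.-tuple R) :
    Omega -> R[i] :=
  fun w => n%:R^-1 * \sum_(i < n) f (X i w).

Definition square_integrable (R : realType) (s : nat)
    (f : s.-tuple R -> R[i]) : Prop :=
  [/\ measurable_fun (unit_cube R s) (fun x => complex.Re (f x)),
      measurable_fun (unit_cube R s) (fun x => complex.Im (f x)) &
      (\int[lebesgue_tuple R s]_(x in unit_cube R s) (normc (f x) ^+ 2)%:E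
        < +oo)%E].

Definition cube_integral (R : realType) (s : nat) (f : s.-tuple R -> R[i]) :
    R[i] :=
  (\int[lebesgue_tuple R s]_(x in unit_cube R s) complex.Re (f x)) +i*
  (\int[lebesgue_tuple R s]_(x in unit_cube R s) complex.Im (f x)).

(* Coefficient of b ^ i in l. *)
Definition nat_digit (b l i : nat) : nat := (l %/ b ^ i %% b)%N.

(* For 0 <= x < 1 and i >= 1, coefficient of b ^ (- i) in the base b expansion
   of x, the finite expansion being chosen when there are two. *)
Definition real_digit (R : realType) (b : nat) (x : R) (i : nat) : nat :=
  (Num.truncn (b%:R ^+ i * x) %% b)%N.

Definition omega (R : realType) (b : nat) : R[i] :=
  cos (2 * pi / b%:R) +i* sin (2 * pi / b%:R).

(* For b >= 2 the digits of l of index at least l vanish, so that i < l bounds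
   the whole sum in the exponent. *)
Definition wal1 (R : realType) (b l : nat) (x : R) : R[i] :=
  omega R b ^+ (\sum_(i < l) nat_digit b l i * real_digit b x i.+1)%N.

Definition wal (R : realType) (b s : nat) (l : {ffun 'I_s -> nat})
    (x : s.-tuple R) : R[i] :=
  \prod_(j < s) wal1 b (l j) (tnth x j).

Definition walsh_coef (R : realType) (b s : nat) (f : s.-tuple R -> R[i])
    (l : {ffun 'I_s -> nat}) : R[i] :=
  cube_integral (fun x => f x * conjc (wal b l x)).

(* b ^ k %/ b is the floor of b ^ (k - 1), also when k = 0. *)
Definition walsh_block (b s : nat) (k : {ffun 'I_s -> nat}) :
    set {ffun 'I_s -> nat} :=
  [set l | forall j, (b ^ k j %/ b <= l j < b ^ k j)%N].

Definition sigma2 (R : realType) (b s : nat) (f : s.-tuple R -> R[i])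
    (k : {ffun 'I_s -> nat}) : R :=
  \sum_(l \in walsh_block b k) normc (walsh_coef b f l) ^+ 2.

(* Main.v *)
(* All coordinates are cut into the cells of side b^-m, on which the Walsh
   functions of index below b^m are constant, so that everything becomes a finite
   sum over pairs of cells. Orthogonality of characters diagonalizes the indicator
   of D_i on pairs of cells, and the hypothesis on the spectrum of f makes the
   resulting sum a product over coordinates: if (V_l, V_j) is in D_i then
   E[f(U_l) conj f(U_j)] = alpha * prod_j (1 - x) (1 + bx + ... + (bx)^(i_j)),
   while |E f|^2 = alpha. Expanding the products, the average over l <> j becomes
   (1 - x)^s * sum_k (bx)^|k| q_k, where q_k is the proportion of pairs of net
   points that share an elementary interval of shape k. In a (0, m, s)-net
   q_k <= b^-|k|, so the average is at most alpha ((1 - x) (1 + x + x^2 + ...))^s,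
   that is alpha. *)

Require Import Defs.
From mathcomp Require Import all_boot all_order all_algebra.
From mathcomp Require Import complex.
From mathcomp Require Import all_classical all_reals all_analysis.
From mathcomp Require Import measurable_realfun ring lra zify.

Set Implicit Arguments.
Unset Strict Implicit.
Unset Printing Implicit Defensive.

Import Order.TTheory GRing.Theory Num.Theory.
Import numFieldNormedType.Exports.

Local Open Scope classical_set_scope.
Local Open Scope ring_scope.

(** * Base b digits and characters *)

(** Resolution b^-m suffices because a slab that fixes m digits of a single coordinate contains
    exactly one net point: two distinct points differ within their first m digits in every
    coordinate. So only sets D_i with all i_j < m occur, each is a finite union of products of
    cells, and [f] enters only through its integrals over cells.

    The factor (1 - x)(1 + bx + ... + (bx)^i) is the outcome of a cancellation. In one coordinate
    the indicator of exactly i common digits is the kernel of at least i common digits minus that of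
    at least i + 1; these have weight b^-i on indices with at most i digits and b^-(i+1) on indices
    with at most i + 1. The prescribed spectrum summed over at most i digits is the factor above
    plus x (bx)^i. In the difference the excess disappears and b^-i (1 - 1/b) comes out, which is
    the one-coordinate volume of D_i.

    The bound on pairs holds for each fixed l, so it serves both claims: the covariance is an
    average of such rows, and the two variances share their diagonal terms and differ only in these
    rows. *)

Lemma realcM (R : rcfType) (x y : R) : (x * y)%:C%C = x%:C%C * y%:C%C.
Proof. exact: rmorphM. Qed.

Lemma realcB (R : rcfType) (x y : R) : (x - y)%:C%C = x%:C%C - y%:C%C.
Proof. exact: rmorphB. Qed.

Lemma realc_nat (R : rcfType) n : (n%:R : R)%:C%C = n%:R.
Proof. exact: rmorph_nat. Qed.

Lemma realc_sum (R : rcfType) (I : Type) (r : seq I) (P : pred I) (F : I -> R) :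
  (\sum_(i <- r | P i) F i)%:C%C = \sum_(i <- r | P i) (F i)%:C%C.
Proof. exact: rmorph_sum. Qed.

Lemma realc_prod (R : rcfType) (I : Type) (r : seq I) (P : pred I) (F : I -> R) :
  (\prod_(i <- r | P i) F i)%:C%C = \prod_(i <- r | P i) (F i)%:C%C.
Proof. exact: rmorph_prod. Qed.

Lemma conjcX (R : rcfType) (z : R[i]) n : conjc (z ^+ n) = conjc z ^+ n.
Proof. exact: rmorphXn. Qed.

Lemma conjcM (R : rcfType) (z t : R[i]) : conjc (z * t) = conjc z * conjc t.
Proof. exact: rmorphM. Qed.

Lemma conjcB (R : rcfType) (z t : R[i]) : conjc (z - t) = conjc z - conjc t.
Proof. exact: rmorphB. Qed.

Lemma conjc_sum (R : rcfType) (I : Type) (r : seq I) (P : pred I) (F : I -> R[i]) :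
  conjc (\sum_(i <- r | P i) F i) = \sum_(i <- r | P i) conjc (F i).
Proof. exact: rmorph_sum. Qed.

Lemma conjc_prod (R : rcfType) (I : Type) (r : seq I) (P : pred I) (F : I -> R[i]) :
  conjc (\prod_(i <- r | P i) F i) = \prod_(i <- r | P i) conjc (F i).
Proof. exact: rmorph_prod. Qed.

Lemma divn_prefixS (b m k c : nat) : (0 < b)%N -> (k < m)%N ->
  (c %/ b ^ (m - k.+1) = c %/ b ^ (m - k) * b + c %/ b ^ (m - k.+1) %% b)%N.
Proof.
move=> b0 km; rewrite {1}(divn_eq (c %/ b ^ (m - k.+1)) b) -divnMA -expnSr.
by rewrite -subSn.
Qed.

(* c < b ^ m stands for the interval [c b^-m, (c + 1) b^-m), whose points have the
   base b digits of c as their first m digits, most significant first. *)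
Definition common_prefix (b m k c c' : nat) : bool :=
  (c %/ b ^ (m - k) == c' %/ b ^ (m - k))%N.

Lemma common_prefixS (b m k c c' : nat) : (0 < b)%N -> (k < m)%N ->
  common_prefix b m k.+1 c c' =
  common_prefix b m k c c' &&
    (c %/ b ^ (m - k.+1) %% b == c' %/ b ^ (m - k.+1) %% b)%N.
Proof.
move=> b0 km; apply/eqP/andP => [e|[/eqP e1 /eqP e2]]; last first.
  by rewrite divn_prefixS // e1 e2 -divn_prefixS.
rewrite e eqxx; split=> //; apply/eqP.
by rewrite -(subnSK km) expnSr !divnMA e.
Qed.

Lemma common_prefix0 (b m c c' : nat) : (c < b ^ m)%N -> (c' < b ^ m)%N ->
  common_prefix b m 0 c c'.
Proof. by move=> lc lc'; rewrite /common_prefix subn0 !divn_small. Qed.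

Lemma common_prefix_le (b m k k' c c' : nat) : (0 < b)%N -> (k <= k')%N -> (k' <= m)%N ->
  common_prefix b m k' c c' -> common_prefix b m k c c'.
Proof.
move=> b0 + k'm; elim: k' k'm => [|k' IH] k'm; first by rewrite leqn0 => /eqP ->.
rewrite leq_eqVlt => /predU1P[->//|kk'].
by rewrite common_prefixS // => /andP[+ _]; apply: IH => //; exact: ltnW.
Qed.

Lemma common_prefix_full (b m c c' : nat) : common_prefix b m m c c' = (c == c').
Proof. by rewrite /common_prefix subnn expn0 !divn1. Qed.

(** The lengths of common prefixes form an initial segment, which contains 0 and misses m since a
    common prefix of full length means equality. The threshold form serves later to replace a prefix
    test by an inequality. *)
Lemma first_difference (b m c c' : nat) : (0 < b)%N ->
    (c < b ^ m)%N -> (c' < b ^ m)%N -> c != c' ->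
  exists2 i, (i < m)%N &
    forall k, (k <= m)%N -> common_prefix b m k c c' = (k <= i)%N.
Proof.
move=> b0 lc lc' cc'.
have ex : exists k, common_prefix b m k c c' && (k <= m)%N.
  by exists 0; rewrite common_prefix0.
have ub k : common_prefix b m k c c' && (k <= m)%N -> (k <= m)%N by case/andP.
case: (ex_maxnP ex ub) => i /andP[pi im] maxi; exists i.
  rewrite ltn_neqAle im andbT; apply: contra cc' => /eqP im'.
  by rewrite -(common_prefix_full b m) -{2}im'.
move=> k km; apply/idP/idP => [pk|ki]; first by apply: maxi; rewrite pk.
exact: common_prefix_le pi.
Qed.

Lemma sum_nat_block (V : nmodType) (b n : nat) (F : nat -> V) :
  \sum_(0 <= i < n * b) F i = \sum_(0 <= i < n) \sum_(0 <= j < b) F (i * b + j)%N.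
Proof.
rewrite big_nat_mul; apply: eq_bigr => i _.
by rewrite -{1}[(i * b)%N]add0n big_addn mulSn addnK; apply: eq_bigr => j _; rewrite addnC.
Qed.

(** For fixed [c] the matching [c'] form one block of b^(m-k) consecutive integers, those with the
    same quotient. *)
Lemma sum_common_prefix (R : pzSemiRingType) (b m k : nat) : (0 < b)%N -> (k <= m)%N ->
  \sum_(0 <= c < b ^ m) \sum_(0 <= c' < b ^ m) (common_prefix b m k c c')%:R =
  (b ^ m * b ^ (m - k))%:R :> R.
Proof.
move=> b0 km.
suff H c : (c < b ^ m)%N ->
    \sum_(0 <= c' < b ^ m) (common_prefix b m k c c')%:R = (b ^ (m - k))%:R :> R.
  rewrite big_nat (eq_bigr (fun=> (b ^ (m - k))%:R)) => [|c /H //].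
  by rewrite -big_nat sumr_const_nat subn0 natrM mulr_natl.
move=> cb; set d := (b ^ (m - k))%N.
have d0 : (0 < d)%N by rewrite expn_gt0 b0.
have bd : (b ^ m = b ^ k * d)%N by rewrite -expnD subnKC.
have cd : (c %/ d < b ^ k)%N by rewrite ltn_divLR // -bd.
rewrite bd sum_nat_block -/d big_mkord (bigD1 (Ordinal cd)) //=.
rewrite [X in _ + X]big1 ?addr0 => [|i ic].
  rewrite big_nat (eq_bigr (fun=> 1)) => [|j /= jd].
    by rewrite -big_nat sumr_const_nat subn0.
  by rewrite /common_prefix -/d divnMDl // (divn_small jd) addn0 eqxx.
rewrite big_nat big1 // => j /= jd.
rewrite /common_prefix -/d divnMDl // (divn_small jd) addn0.
by case: eqP => // e; case/eqP: ic; apply/val_inj; rewrite /= e.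
Qed.

Section root_of_unity.
Variables (R : realType) (b : nat).
Hypothesis b_prime : prime b.
Let b_gt1 : (1 < b)%N := prime_gt1 b_prime.
Local Notation w := (omega R b).

Lemma omegaX n : w ^+ n = (cos (n%:R * (2 * pi / b%:R)) +i* sin (n%:R * (2 * pi / b%:R)))%C.
Proof.
elim: n => [|n IH]; first by rewrite expr0 mul0r cos0 sin0.
rewrite exprS IH /omega -[n.+1%:R]natr1 [in RHS]mulrDl mul1r. rewrite cosD sinD.
by apply/eqP; rewrite eq_complex /=; apply/andP; split; apply/eqP; ring.
Qed.

Lemma omegaXb : w ^+ b = 1.
Proof.
rewrite omegaX mulrC divfK ?pnatr_eq0 -?lt0n ?prime_gt0 //.
by rewrite mulrC mulr_natr cos2pi sin2pi.
Qed.

Lemma omega_neq1 : w != 1.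
Proof.
rewrite eq_complex /= negb_and; apply/orP; left.
have pi0 := pi_gt0 R; have b2 : 2 <= b%:R :> R by rewrite ler_nat.
have b0 : 0 < b%:R :> R by lra.
apply/eqP => e.
suff : 2 * pi / b%:R = 0 :> R.
  apply/eqP; rewrite mulf_neq0 // ?invr_neq0 ?gt_eqF //.
  by rewrite mulr_gt0.
(* Since b >= 2, the angle 2 pi / b lies in [0, pi], where cosine is injective. *)
apply: cos_inj; rewrite ?cos0 // in_itv /= ?lexx ?pi_ge0 //.
by rewrite ler_pdivrMr // divr_ge0 /=; nra.
Qed.

(** The order of [w] divides the prime b and is not 1. *)
Lemma omega_prim : b.-primitive_root w.
Proof.
have [k pk kb] := prim_order_exists (prime_gt0 b_prime) omegaXb.
have /primeP[_ /(_ k kb) /orP[/eqP k1|/eqP kb1]] := b_prime; last by rewrite -{1}kb1.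
move/prim_expr_order: pk; rewrite k1 expr1 => /eqP.
by rewrite (negPf omega_neq1).
Qed.

Lemma omega_conj : w * conjc w = 1.
Proof.
apply/eqP; rewrite eq_complex /=; apply/andP; split; apply/eqP; last by ring.
by rewrite mulrN opprK -!expr2 cos2Dsin2.
Qed.

(** Orthogonality of the characters of Z/b: conjugation inverts [w], so the sum is geometric with
    ratio z = w^u / w^v. Here z^b = 1, and z = 1 only if u = v because [w] is primitive. *)
Lemma sum_omega (u v : nat) : (u < b)%N -> (v < b)%N ->
  \sum_(0 <= t < b) w ^+ (t * u) * conjc (w ^+ (t * v)) = (b * (u == v))%:R.
Proof.
move=> ub vb; have w0 : w != 0.
  apply/eqP => w0; have /eqP := omega_conj.
  by rewrite w0 mul0r eq_sym oner_eq0.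
have cw : conjc w = w^-1 by apply: (mulfI w0); rewrite omega_conj mulfV.
pose z := w ^+ u / w ^+ v.
have -> : \sum_(0 <= t < b) w ^+ (t * u) * conjc (w ^+ (t * v)) =
    \sum_(0 <= t < b) z ^+ t.
  apply: eq_bigr => t _; rewrite conjcX cw exprVn.
  by rewrite mulnC [(t * v)%N]mulnC !exprM -exprVn -exprMn.
have [uv|uv] := eqVneq u v.
  rewrite muln1 (eq_bigr (fun=> 1)) => [|t _]; first by rewrite sumr_const_nat subn0.
  by rewrite /z uv divff ?expf_neq0 // expr1n.
have z1 : z - 1 != 0.
  apply: contra uv; rewrite subr_eq0 => /eqP z1.
  have := eq_prim_root_expr omega_prim u v.
  rewrite !modn_small // => <-.
  by rewrite -[w ^+ u](divfK (expf_neq0 v w0)) -/z z1 mul1r.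
apply: (mulfI z1); rewrite big_mkord -subrX1.
by rewrite /z exprMn exprVn -!exprM [(u * b)%N]mulnC [(v * b)%N]mulnC !exprM omegaXb
  !expr1n invr1 mulr1 subrr muln0 mulr0.
Qed.

End root_of_unity.

(** * Walsh functions on cells *)

Section walsh_kernel.
Variables (R : realType) (b m : nat).
Hypothesis b_prime : prime b.
Local Notation w := (omega R b).
Let b_gt0 : (0 < b)%N := prime_gt0 b_prime.
Let b_gt1 : (1 < b)%N := prime_gt1 b_prime.

(** Digits of a cell are counted from the most significant one, whereas [nat_digit] counts from the
    least significant: this is the pairing of the two in a Walsh function. *)
Definition cell_digit (c i : nat) : nat := (c %/ b ^ (m - i.+1) %% b)%N.

Definition cell_wal (l c : nat) : R[i] :=
  w ^+ (\sum_(i < m) nat_digit b l i * cell_digit c i)%N.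

Lemma nat_digit_small (l i : nat) : (l < b ^ i)%N -> nat_digit b l i = 0%N.
Proof. by move=> li; rewrite /nat_digit divn_small // mod0n. Qed.

Lemma nat_digit_block (k l t i : nat) : (l < b ^ k)%N -> (t < b)%N ->
  nat_digit b (t * b ^ k + l) i = (nat_digit b l i + (i == k) * t)%N.
Proof.
move=> lk tb; have [ik|ki|->] := ltngtP i k.
- rewrite addn0 /nat_digit -(subnK ik) addnS -addSn expnD expnS mulnA.
  by rewrite divnMDl ?expn_gt0 ?b_gt0 // mulnCA mulnC modnMDl.
- rewrite !nat_digit_small //; first exact: leq_trans lk (leq_pexp2l b_gt0 (ltnW ki)).
  apply: (@leq_trans (b ^ k.+1)); last exact: leq_pexp2l.
  rewrite expnS; apply: (@leq_trans (t.+1 * b ^ k)); first by rewrite mulSn addnC ltn_add2r.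
  exact: leq_mul.
- rewrite mul1n (nat_digit_small lk) /nat_digit divnMDl ?expn_gt0 ?b_gt0 //.
  by rewrite (divn_small lk) addn0 modn_small.
Qed.

Lemma cell_wal_block (k l t c : nat) : (k < m)%N -> (l < b ^ k)%N -> (t < b)%N ->
  cell_wal (t * b ^ k + l) c = cell_wal l c * w ^+ (t * cell_digit c k).
Proof.
move=> km lk tb; rewrite /cell_wal -exprD; congr (_ ^+ _).
rewrite (eq_bigr (fun i : 'I_m =>
    nat_digit b l i * cell_digit c i + (i == k :> nat) * (t * cell_digit c i)))%N.
  rewrite big_split /=; congr addn.
  rewrite (bigD1 (Ordinal km)) //= eqxx mul1n big1 ?addn0 // => i ik.
  suff -> : (i == k :> nat) = false by [].
  by apply: contraNF ik => /eqP ik; apply/eqP/val_inj.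
by move=> i _; rewrite nat_digit_block // mulnDl mulnA.
Qed.

(** The indices below b^k are the characters of the group of first k digits. In the induction an
    index below b^(k+1) is t b^k + l with leading digit t; the sum over t is a character sum that
    tests whether digit k of the two cells agrees, and the sum over l is the previous case. *)
Lemma sum_cell_wal (k c c' : nat) : (k <= m)%N -> (c < b ^ m)%N -> (c' < b ^ m)%N ->
  \sum_(0 <= l < b ^ k) cell_wal l c * conjc (cell_wal l c') =
  (b ^ k * common_prefix b m k c c')%:R.
Proof.
move=> + cb c'b; elim: k => [|k IH] km.
  rewrite expn0 big_nat1 common_prefix0 // /cell_wal !big1 => [|i _|i _].
  - by rewrite expr0 conjc1 mulr1.
  - by rewrite /nat_digit div0n mod0n.
  - by rewrite /nat_digit div0n mod0n.
rewrite expnS sum_nat_block.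
rewrite big_nat (eq_bigr (fun t => (w ^+ (t * cell_digit c k) *
    conjc (w ^+ (t * cell_digit c' k))) *
    (b ^ k * common_prefix b m k c c')%:R)) => [|t tb].
  rewrite -big_nat -mulr_suml sum_omega ?ltn_mod // common_prefixS //.
  rewrite -natrM; congr (_%:R).
  by rewrite -/(cell_digit c k) -/(cell_digit c' k); case: common_prefix; case: eqP; rewrite /=; lia.
rewrite -IH ?(ltnW km) // mulr_sumr big_nat [RHS]big_nat.
apply: eq_bigr => l lk; rewrite !cell_wal_block // conjcM.
by rewrite mulrC mulrACA mulrC; congr (_ * _); rewrite mulrC.
Qed.

End walsh_kernel.

Lemma common_prefixC (b m k c c' : nat) : common_prefix b m k c c' = common_prefix b m k c' c.
Proof. by rewrite /common_prefix eq_sym. Qed.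

Lemma mulc_conj (R : rcfType) (z : R[i]) : z * conjc z = (ComplexField.Normc.normc z ^+ 2)%:C%C.
Proof. by rewrite -sqr_normc normc_def rmorphXn; case: z. Qed.

(** [up_log b l.+1] is the least k with l < b^k. In particular 0 has no digits, so that the index
    sets L_k are exactly the classes of equal digit counts. *)
Definition num_digits (b l : nat) : nat := up_log b l.+1.

Lemma num_digits_le (b l k : nat) : (1 < b)%N -> (num_digits b l <= k)%N = (l < b ^ k)%N.
Proof.
move=> b1; apply/idP/idP => [h|]; last exact: up_log_min.
exact: leq_trans (up_logP l.+1 b1) (leq_pexp2l (ltnW b1) h).
Qed.

Lemma num_digits_eq (b l k : nat) : (1 < b)%N ->
  (num_digits b l == k) = (b ^ k %/ b <= l < b ^ k)%N.
Proof.
move=> b1; rewrite eqn_leq num_digits_le // andbC; congr (_ && _).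
case: k => [|k]; first by rewrite expn0 divn_small.
by rewrite expnS mulKn ?(ltnW b1) // ltnNge num_digits_le // -leqNgt.
Qed.

(** * Diagonal form of the indicator of D_i and the prescribed spectrum *)

Section spectrum.
Variables (R : realType) (b m s : nat).
Hypothesis b_prime : prime b.
Local Notation N := (b ^ m)%N.
Local Notation index := {ffun 'I_s -> 'I_N}.
Local Notation normc := ComplexField.Normc.normc.
Let b_gt0 : (0 < b)%N := prime_gt0 b_prime.
Let b_gt1 : (1 < b)%N := prime_gt1 b_prime.

(** Indicator that exactly [i] leading digits agree, for i < m. As a difference of two prefix
    kernels it is expanded by [sum_cell_wal] term by term. *)
Definition exact_prefix (i c c' : nat) : R :=
  (common_prefix b m i c c')%:R - (common_prefix b m i.+1 c c')%:R.

(** Coefficient of a Walsh function with [k] digits in the expansion of [exact_prefix i]. *)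
Definition digit_weight (i k : nat) : R :=
  (k <= i)%:R / b%:R ^+ i - (k <= i.+1)%:R / b%:R ^+ i.+1.

Lemma exact_prefix_wal (i c c' : nat) : (i < m)%N -> (c < N)%N -> (c' < N)%N ->
  (exact_prefix i c c')%:C%C =
  \sum_(l < N) (digit_weight i (num_digits b l))%:C%C *
     (cell_wal R b m l c' * conjc (cell_wal R b m l c)).
Proof.
move=> im cN c'N.
have H k : (k <= m)%N -> ((common_prefix b m k c c')%:R)%:C%C =
    \sum_(l < N) ((num_digits b l <= k)%N%:R / b%:R ^+ k : R)%:C%C *
     (cell_wal R b m l c' * conjc (cell_wal R b m l c)).
  move=> km; have bk0 : (b%:R ^+ k : R) != 0 by rewrite expf_neq0 // pnatr_eq0 -lt0n.
  apply: (mulfI (x := (b%:R ^+ k : R)%:C%C)).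
    by rewrite fmorph_eq0.
  rewrite -realcM -natrX -natrM realc_nat common_prefixC -sum_cell_wal //.
  rewrite mulr_sumr.
  have bkN : (b ^ k <= N)%N by apply: leq_pexp2l.
  rewrite big_mkord.
  rewrite (big_ord_widen N (fun l => cell_wal R b m l c' * conjc (cell_wal R b m l c)) bkN).
  rewrite [LHS]big_mkcond /=.
  apply: eq_bigr => l _; rewrite num_digits_le //.
  case: ifP => lk; last by rewrite mul0r mul0r mulr0.
  by rewrite mul1r [RHS]mulrA -realcM mulfV ?natrX // mul1r.
rewrite /exact_prefix realcB !H //; last exact: ltnW.
rewrite -sumrB; apply: eq_bigr => l _.
by rewrite -mulrBl -realcB.
Qed.

Definition cell_walsh (l c : index) : R[i] := \prod_j cell_wal R b m (l j) (c j).

Definition cell_coef (F : index -> R[i]) (l : index) : R[i] :=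
  \sum_c F c * conjc (cell_walsh l c).

(** The kernel is a sum over l of a weight times w_l(c') conj(w_l(c)). For each l the double sum
    over cells separates into [cell_coef F l] and its conjugate, hence the squared modulus. *)
Lemma exact_prefix_form (i : 'I_s -> nat) (F : index -> R[i]) :
    (forall j, (i j < m)%N) ->
  \sum_(c : index) \sum_(c' : index) (\prod_j exact_prefix (i j) (c j) (c' j))%:C%C * (F c * conjc (F c')) =
  (\sum_(l : index) (\prod_j digit_weight (i j) (num_digits b (l j))) *
     normc (cell_coef F l) ^+ 2)%:C%C.
Proof.
move=> im.
have E (c c' : index) : (\prod_j exact_prefix (i j) (c j) (c' j))%:C%C =
    \sum_(l : index) \prod_j ((digit_weight (i j) (num_digits b (l j)))%:C%C *
      (cell_wal R b m (l j) (c' j) * conjc (cell_wal R b m (l j) (c j)))).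
  rewrite realc_prod -(bigA_distr_bigA (fun j (l : 'I_N) =>
    (digit_weight (i j) (num_digits b l))%:C%C *
      (cell_wal R b m l (c' j) * conjc (cell_wal R b m l (c j))))).
  by apply: eq_bigr => j _; exact: exact_prefix_wal.
under eq_bigr => c _ do under eq_bigr => c' _ do rewrite E mulr_suml.
rewrite realc_sum; under eq_bigr => c _ do rewrite exchange_big /=.
rewrite exchange_big /=; apply: eq_bigr => l _.
rewrite realcM realc_prod -mulc_conj /cell_coef conjc_sum mulr_suml mulr_sumr.
apply: eq_bigr => c _; rewrite mulr_sumr mulr_sumr; apply: eq_bigr => c' _.
rewrite big_split big_split /= -/(cell_walsh l c') -mulrA; congr (_ * _).
rewrite -conjc_prod -/(cell_walsh l c) conjcM conjcK.
by rewrite mulrACA [cell_walsh l c' * _]mulrC mulrACA; congr (_ * _); rewrite mulrC.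
Qed.

(** The weights see l only through its digit counts, hence are constant on each L_k; the class sums
    are products, and distributivity turns the sum over k into a product over coordinates. It is
    applied with [A] the squared Walsh coefficients and [g] the [block_factor]. *)
Lemma sum_by_num_digits (A : index -> R) (g : nat -> R) (alpha : R) (v : 'I_s -> nat -> R) :
  (forall k : {ffun 'I_s -> nat}, (forall j, (k j <= m)%N) ->
    \sum_(l : index | [forall j, num_digits b (l j) == k j]) A l = (\prod_j g (k j)) * alpha) ->
  \sum_(l : index) (\prod_j v j (num_digits b (l j))) * A l =
  (\prod_j \sum_(k < m.+1) v j k * g k) * alpha.
Proof.
move=> hA; have lm (l : 'I_N) : (num_digits b l < m.+1)%N by rewrite ltnS num_digits_le.
rewrite bigA_distr_bigA mulr_suml /=.
rewrite (partition_big (fun l : index => [ffun j => Ordinal (lm (l j))]) predT) //=.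
apply: eq_bigr => k _.
rewrite (eq_bigr (fun l => (\prod_j v j (k j)) * A l)) => [|l /eqP <-]; last first.
  by congr (_ * _); apply: eq_bigr => j _; rewrite ffunE.
rewrite -mulr_sumr big_split /= -mulrA; congr (_ * _).
transitivity ((\prod_j g ([ffun j => (k j : nat)] j)) * alpha); last first.
  by congr (_ * _); apply: eq_bigr => j _; rewrite ffunE.
rewrite -hA => [|j]; last by rewrite ffunE -ltnS.
apply: eq_bigl => l; apply/eqP/forallP => [<- j|H].
  by rewrite !ffunE.
by apply/ffunP => j; apply/val_inj; rewrite ffunE /=; have /eqP := H j; rewrite ffunE.
Qed.

Lemma sum_exact_prefix (i : 'I_s -> nat) : (forall j, (i j < m)%N) ->
  \sum_(c : index) \sum_(c' : index) \prod_j exact_prefix (i j) (c j) (c' j) =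
  \prod_j ((N%:R ^+ 2) * (b%:R ^- i j * (1 - b%:R^-1))).
Proof.
move=> im; have bR0 : b%:R != 0 :> R by rewrite pnatr_eq0 -lt0n.
have E (c : index) : \sum_(c' : index) \prod_j exact_prefix (i j) (c j) (c' j) =
    \prod_j \sum_(c' < N) exact_prefix (i j) (c j) c'.
  by rewrite bigA_distr_bigA.
rewrite (eq_bigr _ (fun c _ => E c)) -(bigA_distr_bigA (fun j (c : 'I_N) =>
    \sum_(c' < N) exact_prefix (i j) c c')).
apply: eq_bigr => j _.
transitivity (\sum_(0 <= c < N) \sum_(0 <= c' < N) exact_prefix (i j) c c').
  by rewrite big_mkord; apply: eq_bigr => c _; rewrite big_mkord.
rewrite /exact_prefix; under eq_bigr do rewrite sumrB.
rewrite sumrB !sum_common_prefix // ?(ltnW (im j)) // !natrM -mulrBr expr2 -mulrA.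
(* With m = i + e + 1 both truncated subtractions become plain exponents, and the claim is an
   identity between powers of b. *)
congr (_ * _); pose e := (m - (i j).+1)%N.
have e1 : (m - i j = e.+1)%N by rewrite /e subnSK.
have -> : (N = b ^ i j * b ^ e.+1)%N by rewrite -expnD -e1 subnKC // ltnW.
rewrite e1 -/e natrM !natrX.
have bi0 : b%:R ^+ i j != 0 :> R by rewrite expf_neq0.
by rewrite !exprS; field; rewrite bR0 bi0.
Qed.

(** Contribution of one coordinate to sigma_k^2 / alpha. The value at 0 is separate since r counts
    only non-zero coordinates. *)
Definition block_factor (x : R) (k : nat) : R :=
  if k == 0%N then 1 else (b%:R - 1) / b%:R * (b%:R * x) ^+ k.

(* Factor of E[f(U_l) conj f(U_j)] / alpha due to a coordinate in which V_l and V_j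
   have exactly i common digits. *)
Definition pair_factor (x : R) (i : nat) : R :=
  (1 - x) * \sum_(t < i.+1) (b%:R * x) ^+ t.

(** The term x (bx)^i is the excess that cancels in [sum_digit_weight]. *)
Lemma sum_block_factor (x : R) (i : nat) :
  \sum_(k < i.+1) block_factor x k = pair_factor x i + x * (b%:R * x) ^+ i.
Proof.
have bR0 : b%:R != 0 :> R by rewrite pnatr_eq0 -lt0n.
elim: i => [|i IH].
  by rewrite /pair_factor !big_ord1 /block_factor /= !expr0; ring.
rewrite big_ord_recr /= IH /pair_factor [in RHS]big_ord_recr /= /block_factor /=.
by rewrite exprS; field.
Qed.

Lemma sum_digit_weight (x : R) (i : nat) : (i < m)%N ->
  \sum_(k < m.+1) digit_weight i k * block_factor x k =
  b%:R ^- i * (1 - b%:R^-1) * pair_factor x i.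
Proof.
move=> im; have bR0 : b%:R != 0 :> R by rewrite pnatr_eq0 -lt0n.
have H e : (e <= m)%N -> \sum_(k < m.+1) (k <= e)%:R * block_factor x k =
    \sum_(k < e.+1) block_factor x k.
  move=> em; rewrite [RHS](big_ord_widen m.+1) // [RHS]big_mkcond /=.
  by apply: eq_bigr => k _; rewrite ltnS; case: leqP; rewrite ?mul1r ?mul0r.
under eq_bigr => k _ do rewrite /digit_weight mulrBl mulrAC [X in _ - X]mulrAC.
rewrite sumrB -!mulr_suml !H // ?(ltnW im) // [in X in _ - X]big_ord_recr /=.
rewrite !sum_block_factor /block_factor /= exprS.
have bi0 : b%:R ^+ i != 0 :> R by rewrite expf_neq0.
by rewrite exprS; field; rewrite bR0 bi0.
Qed.

Lemma prod_block_factor (x : R) (k : {ffun 'I_s -> nat}) :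
  ((b%:R - 1) / b%:R) ^+ #|[pred j | k j != 0%N]| * (b%:R * x) ^+ (\sum_j k j)%N =
  \prod_j block_factor x (k j).
Proof.
rewrite -prodr_const -prodrXr big_mkcond -big_split /=; apply: eq_bigr => j _.
by rewrite /block_factor inE; case: eqP => [->|_] //=; rewrite mul1r expr0.
Qed.

End spectrum.

(** * Counting pairs of points of a net *)

(** Two naturals with the same lower bounds are equal: [a] is below either side iff a b^(m-k) <= b^m
    v. *)
Lemma truncn_prefix (R : realType) (b m k : nat) (v : R) : (0 < b)%N -> 0 <= v -> (k <= m)%N ->
  Num.truncn (b%:R ^+ k * v) = (Num.truncn (b%:R ^+ m * v) %/ b ^ (m - k))%N.
Proof.
move=> b0 v0 km.
suff H a : (a <= Num.truncn (b%:R ^+ k * v))%N =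
    (a <= Num.truncn (b%:R ^+ m * v) %/ b ^ (m - k))%N.
  by apply/eqP; rewrite eqn_leq -H leqnn H leqnn.
rewrite leq_divRL ?expn_gt0 ?b0 // !truncn_ge_nat ?mulr_ge0 ?exprn_ge0 //.
rewrite natrM natrX -{2}(subnK km) exprD -mulrA [X in _ = (_ <= X)]mulrC [RHS]ler_pM2r //.
by rewrite exprn_gt0 // ltr0n.
Qed.

Lemma truncn_lt_exp (R : realType) (b k : nat) (v : R) : (0 < b)%N -> 0 <= v < 1 ->
  (Num.truncn (b%:R ^+ k * v) < b ^ k)%N.
Proof.
move=> b0 /andP[v0 v1]; rewrite truncn_lt_nat ?mulr_ge0 ?exprn_ge0 // natrX.
by rewrite -[ltRHS]mulr1 ltr_pM2l // exprn_gt0 // ltr0n.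
Qed.

Lemma truncn_eq_itv (R : realType) (b k a : nat) (v : R) : (0 < b)%N -> 0 <= v ->
  (Num.truncn (b%:R ^+ k * v) == a) = (a%:R / b%:R ^+ k <= v < a.+1%:R / b%:R ^+ k).
Proof.
move=> b0 v0; rewrite truncn_eq ?mulr_ge0 ?exprn_ge0 //.
have bk : 0 < b%:R ^+ k :> R by rewrite exprn_gt0 // ltr0n.
by rewrite ler_pdivrMr // ltr_pdivlMr // [_ * v]mulrC.
Qed.

(** Induction on the excess over [n], taking one unit off a non-zero coordinate each time. It
    coarsens a shape with |k| > m to one with |k'| = m, to which the net property applies. *)
Lemma ex_sum_eq (s n : nat) (k : {ffun 'I_s -> nat}) : (n <= \sum_j k j)%N ->
  exists2 k' : {ffun 'I_s -> nat}, (forall j, (k' j <= k j)%N) & (\sum_j k' j)%N = n.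
Proof.
move: {2}(\sum_j k j - n)%N (leqnn (\sum_j k j - n)%N) => e.
elim: e k => [|e IH] k he hn.
  by exists k => //; apply/eqP; rewrite eqn_leq hn -subn_eq0 -leqn0 he.
have [E|ne] := eqVneq (\sum_j k j)%N n; first by exists k.
have [j kj] : exists j, (0 < k j)%N.
  apply/existsP; apply: contra_neqT ne => /existsPn k0.
  have k00 : (\sum_j k j)%N = 0%N by apply: big1 => j _; apply/eqP; rewrite -leqn0 leqNgt.
  by move: hn; rewrite k00 leqn0 => /eqP ->.
pose k1 : {ffun 'I_s -> nat} := [ffun t => (k t - (t == j))%N].
have sk1 : (\sum_t k t = (\sum_t k1 t).+1)%N.
  rewrite (bigD1 j) //= [in RHS](bigD1 j) //= ffunE eqxx subn1 -addSn prednK //.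
  congr addn; apply: eq_bigr => t /negPf tj.
  by rewrite ffunE tj subn0.
have [||k' k'k sk'] := IH k1.
- by move: he; rewrite sk1; lia.
- by move: hn; rewrite leq_eqVlt eq_sym (negPf ne) /= sk1 ltnS.
exists k' => // t; apply: leq_trans (k'k t) _.
by rewrite ffunE leq_subr.
Qed.

Section net.
Variables (R : realType) (b m s : nat).
Hypothesis b_prime : prime b.
Local Notation N := (b ^ m)%N.
Let b_gt0 : (0 < b)%N := prime_gt0 b_prime.
Let b_gt1 : (1 < b)%N := prime_gt1 b_prime.
Variable V : 'I_N -> s.-tuple R.
Hypothesis V_net : is_net V.

Definition net_digits (l : 'I_N) (t : 'I_s) : nat :=
  Num.truncn (b%:R ^+ m * tnth (V l) t).

Let V_ge0 l t : 0 <= tnth (V l) t.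
Proof. by case: V_net => /(_ l t) /andP[]. Qed.

Lemma net_digits_lt l t : (net_digits l t < N)%N.
Proof. by case: V_net => /(_ l t) vt _; apply: truncn_lt_exp. Qed.

Definition same_cell (k : 'I_s -> nat) (l l' : 'I_N) : bool :=
  [forall t, common_prefix b m (k t) (net_digits l t) (net_digits l' t)].

(** The points counted are those in the elementary interval of shape [k] around [V l]; its position
    [a] is read off from the leading digits of [V l]. *)
Lemma card_same_cell (k : {ffun 'I_s -> nat}) (l : 'I_N) : (\sum_t k t <= m)%N ->
  #|[pred l' | same_cell k l l']| = (b ^ (m - \sum_t k t))%N.
Proof.
move=> km; have kt t : (k t <= m)%N.
  by apply: leq_trans km; rewrite (bigD1 t) //= leq_addr.
case: V_net => cube /(_ k km) eqd.
pose a : {ffun 'I_s -> nat} := [ffun t => Num.truncn (b%:R ^+ k t * tnth (V l) t)].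
have ab t : (a t < b ^ k t)%N by rewrite ffunE; apply: truncn_lt_exp => //; exact: cube.
move/(_ a ab): eqd; rewrite subzn // -exprnP -natrX => /eqP; rewrite eqr_nat => /eqP <-.
apply: eq_card => l'; rewrite !inE; apply: eq_forallb => t.
rewrite -truncn_eq_itv // ffunE /common_prefix eq_sym /net_digits.
by rewrite !(@truncn_prefix _ b m (k t)).
Qed.

Lemma same_cell_refl k l : same_cell k l l.
Proof. by apply/forallP => t; rewrite /common_prefix. Qed.

(* For |k| > m the count is 0, as a coarser shape k' with |k'| = m already separates
   the points. *)
Lemma card_same_cell_other (k : {ffun 'I_s -> nat}) (l : 'I_N) : (forall t, (k t <= m)%N) ->
  (#|[pred l' | (l' != l) && same_cell k l l']| * b ^ (\sum_t k t) <= N.-1)%N.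
Proof.
move=> kt.
have H (k' : {ffun 'I_s -> nat}) : (\sum_t k' t <= m)%N ->
    #|[pred l' | (l' != l) && same_cell k' l l']| = (b ^ (m - \sum_t k' t)).-1.
  move=> k'm; rewrite -(@card_same_cell k' l) // (cardD1 l [pred l' | same_cell k' l l']) inE.
  by rewrite same_cell_refl add1n /=; apply: eq_card => l'; rewrite !inE.
have [km|mk] := leqP (\sum_t k t) m.
  (* Leaving out [l] itself turns the product into b^m - b^|k|, and b^|k| >= 1. *)
  rewrite H // -subn1 mulnBl mul1n -expnD subnK // -subn1.
  by rewrite leq_sub2l // expn_gt0 b_gt0.
have [k' k'k sk'] := ex_sum_eq (ltnW mk).
suff /eqP -> : #|[pred l' | (l' != l) && same_cell k l l']| == 0%N by [].
rewrite -leqn0; have <- : (b ^ (m - \sum_t k' t)).-1 = 0%N by rewrite sk' subnn.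
rewrite -H ?sk' //; apply: subset_leq_card; apply/fintype.subsetP => l'; rewrite !inE.
move=> /andP[-> /forallP h] /=; apply/forallP => t.
exact: common_prefix_le (h t).
Qed.

Lemma net_first_difference (l l' : 'I_N) : l != l' ->
  exists i : {ffun 'I_s -> nat}, forall t, (i t < m)%N /\
    forall k, (k <= m)%N ->
      common_prefix b m k (net_digits l t) (net_digits l' t) = (k <= i t)%N.
Proof.
move=> ll'.
have D t : net_digits l t != net_digits l' t.
  (* All m digits are spent on coordinate t, so this interval holds only one net point; a second
     point with the same digits there would give a count of at least 1, and 1 * b^m exceeds b^m -
     1. *)
  pose k : {ffun 'I_s -> nat} := [ffun u => if u == t then m else 0%N].
  have sk : (\sum_u k u = m)%N.
    by rewrite (bigD1 t) //= ffunE eqxx big1 ?addn0 // => u /negPf ut; rewrite ffunE ut.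
  have := @card_same_cell_other k l.
  rewrite sk => /(_ _) h; apply: contraTneq (h _); last first.
    by move=> u; rewrite ffunE; case: ifP.
  move=> e; have l'in : l' \in [pred l' | (l' != l) && same_cell k l l'].
    rewrite !inE eq_sym ll'; apply/forallP => u; rewrite ffunE; case: eqP => [->|_].
      by rewrite common_prefix_full e.
    by apply: common_prefix0; exact: net_digits_lt.
  rewrite -ltnNge (cardD1 l') l'in add1n mulSn ltn_addr //.
  by rewrite prednK ?expn_gt0 ?b_gt0.
have E t : exists i, (i < m)%N /\ forall k, (k <= m)%N ->
      common_prefix b m k (net_digits l t) (net_digits l' t) = (k <= i)%N.
  have [i im hi] := first_difference b_gt0 (net_digits_lt l t) (net_digits_lt l' t) (D t).
  by exists i.
pose i := fun t => projT1 (cid (E t)).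
by exists [ffun t => i t] => t; rewrite ffunE; exact: projT2 (cid (E t)).
Qed.

Variables (x : R) (gamma : 'I_N -> 'I_N -> 'I_s -> nat).
Hypotheses (x_ge0 : 0 <= x) (x_le1 : x <= 1).
Hypothesis gammaP : forall l l', l != l' -> forall t, (gamma l l' t < m)%N /\
    forall k, (k <= m)%N ->
      common_prefix b m k (net_digits l t) (net_digits l' t) = (k <= gamma l l' t)%N.

(** No average over [l] is taken: every row is bounded. Since all common digit counts are below m,
    only k_t < m occur, and the geometric series is the finite sum (1 - x)(1 + ... + x^(m-1)) = 1 -
    x^m <= 1. *)
Lemma sum_pair_factor_le l :
  \sum_(l' | l' != l) \prod_t pair_factor b x (gamma l l' t) <= N.-1%:R.
Proof.
have E l' : l' != l -> \prod_t pair_factor b x (gamma l l' t) =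
    (1 - x) ^+ s * \sum_(k : {ffun 'I_s -> 'I_m})
      (same_cell (fun t => k t) l l')%:R * \prod_t (b%:R * x) ^+ k t.
  move=> l'l; rewrite /pair_factor big_split /= prodr_const card_ord; congr (_ * _).
  (* The range k <= gamma becomes an indicator, so that all coordinates sum over the same set and
     the product distributes. The product of the indicators says that the two points share an
     interval of shape k. *)
  rewrite (eq_bigr (fun t => \sum_(k < m) (k <= gamma l l' t)%N%:R * (b%:R * x) ^+ k)).
    rewrite bigA_distr_bigA; apply: eq_bigr => k _; rewrite big_split /=; congr (_ * _).
    have [/forallP h|/forallPn [t h]] := boolP (same_cell _ _ _).
      apply: big1 => t _; rewrite eq_sym in l'l; have [_ <-] := gammaP l'l t; last exact: ltnW.
      by rewrite h.
    rewrite (bigD1 t) //=; rewrite eq_sym in l'l; have [_ <-] := gammaP l'l t; last exact: ltnW.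
    by rewrite (negPf h) mul0r.
  move=> t _; rewrite eq_sym in l'l; have [gm _] := gammaP l'l t.
  rewrite (big_ord_widen m (fun k => (b%:R * x) ^+ k) gm) big_mkcond.
  by apply: eq_bigr => k _; rewrite ltnS; case: leqP; rewrite ?mul1r ?mul0r.
rewrite (eq_bigr _ E) -mulr_sumr exchange_big /=.
apply: (@le_trans _ _ ((1 - x) ^+ s * \sum_(k : {ffun 'I_s -> 'I_m}) N.-1%:R * \prod_t x ^+ k t)).
  apply: ler_wpM2l; first by rewrite exprn_ge0 // subr_ge0.
  apply: ler_sum => k _; rewrite -mulr_suml.
  under [X in _ * X]eq_bigr do rewrite exprMn.
  rewrite big_split /= mulrA; apply: ler_wpM2r.
    by apply: prodr_ge0 => t _; rewrite exprn_ge0.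
  pose k' : {ffun 'I_s -> nat} := [ffun t => (k t : nat)].
  have := @card_same_cell_other k' l; rewrite -(ler_nat R) natrM natrX => h.
  apply: le_trans (h _) => {h}; last by move=> t; rewrite ffunE ltnW.
  rewrite -sum1_card natr_sum big_mkcondr /= -prodrXr.
  rewrite le_eqVlt; apply/orP; left; apply/eqP; congr (_ * _).
    apply: eq_bigr => l' _; rewrite (_ : same_cell _ _ _ = same_cell k' l l').
      by case: same_cell.
    by apply: eq_forallb => t; rewrite ffunE.
  by apply: eq_bigr => t _; rewrite ffunE.
rewrite -mulr_sumr mulrCA -[leRHS]mulr1; apply: ler_wpM2l => //.
rewrite -(bigA_distr_bigA (fun (t : 'I_s) (k : 'I_m) => x ^+ k)).
rewrite prodr_const card_ord -exprMn exprn_ile1 //.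
  by rewrite mulr_ge0 ?subr_ge0 // sumr_ge0 // => k _; rewrite exprn_ge0.
have := subrX1 x m; have : 0 <= x ^+ m by rewrite exprn_ge0.
by nra.
Qed.

End net.

(** * Integrals of complex-valued functions *)

Section transfer.
Local Open Scope ereal_scope.
Context d1 d2 d3 (W : measurableType d1) (S : measurableType d2) (T : measurableType d3)
  (R : realType).
Variables (P : {measure set W -> \bar R}) (nu : {measure set S -> \bar R}).
Variables (X : W -> T) (Y : S -> T) (A : set W) (D : set S) (c : {nonneg R}).
Hypotheses (mX : measurable_fun setT X) (mY : measurable_fun setT Y).
Hypotheses (mA : measurable A) (mD : measurable D).
(* Y = id gives uniform distributions; nu = P and Y = X give the independence of
   the event A from X. *)
Hypothesis PXE : forall B, measurable B ->
  P (A `&` X @^-1` B) = c%:num%:E * nu (D `&` Y @^-1` B).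

(** Both integrals are integrals of [f] against the image of a restricted measure, and [PXE] says
    that the two image measures agree up to the factor [c]. *)
Lemma ge0_integral_transfer (f : T -> \bar R) : measurable_fun setT f ->
    (forall t, 0 <= f t) ->
  \int[P]_(w in A) f (X w) = c%:num%:E * \int[nu]_(z in D) f (Y z).
Proof.
move=> mf f0.
have restrE d (V : measurableType d) (mu : {measure set V -> \bar R}) (Z : V -> T)
    (E : set V) (mE : measurable E) : measurable_fun setT Z ->
    \int[mu]_(v in E) f (Z v) = \int[pushforward (mrestr mu mE) Z]_t f t.
  move=> mZ; have mfZ : measurable_fun setT (fun v => f (Z v)) by exact: measurableT_comp mf mZ.
  rewrite [RHS]ge0_integral_pushforward // preimage_setT.
  rewrite (@ge0_negligible_integral _ _ _ (mrestr mu mE) setT (~` E)) //; last 3 first.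
  - exact: measurableC.
  - by move=> v _; exact: f0.
  - by rewrite /= /mrestr setICl measure0.
  rewrite setTD setCK; apply: eq_measure_integral => B mB BE.
  by rewrite /= /mrestr setIidl.
rewrite (restrE _ _ P _ _ mA mX) (restrE _ _ nu _ _ mD mY).
rewrite -(ge0_integral_mscale _ _ c) //.
apply: eq_measure_integral => B mB _.
by rewrite /= /mscale /= /pushforward /= /mrestr setIC PXE // setIC.
Qed.

Lemma integrable_transfer (f : T -> \bar R) : measurable_fun setT f ->
  nu.-integrable D (f \o Y) -> P.-integrable A (f \o X).
Proof.
move=> mf /integrableP[_ foo]; apply/integrableP; split.
  by apply: (measurable_funS measurableT) => //; exact: measurableT_comp.
rewrite (@ge0_integral_transfer (abse \o f)) => [||t]; first last.
- exact: abse_ge0.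
- exact: measurableT_comp.
by rewrite lte_mul_pinfty.
Qed.

Lemma integral_transfer (f : T -> \bar R) : measurable_fun setT f ->
    nu.-integrable D (f \o Y) ->
  \int[P]_(w in A) f (X w) = c%:num%:E * \int[nu]_(z in D) f (Y z).
Proof.
move=> mf nuf; rewrite [LHS]integralE [in RHS]integralE.
transitivity (c%:num%:E * \int[nu]_(z in D) f^\+ (Y z) - c%:num%:E * \int[nu]_(z in D) f^\- (Y z)).
  rewrite -!ge0_integral_transfer //; first last.
  - exact: measurable_funepos.
  - exact: measurable_funeneg.
  by rewrite (funepos_comp f X) (funeneg_comp f X).
have fi : \int[nu]_(z in D) (f \o Y)^\+ z \is a fin_num.
  exact/integrable_pos_fin_num.
rewrite [RHS]muleBr ?fin_num_adde_defr //.
by rewrite (funepos_comp f Y) (funeneg_comp f Y).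
Qed.

End transfer.

Section complex_integral.
Context (R : realType) (d : measure_display) (T : measurableType d).
Implicit Types (F G : T -> R[i]) (a : R[i]).
Local Notation Re := complex.Re.
Local Notation Im := complex.Im.
Local Notation normc := ComplexField.Normc.normc.

Definition cmeasurable F : Prop :=
  measurable_fun setT (fun x => Re (F x)) /\ measurable_fun setT (fun x => Im (F x)).

Lemma cReM (z t : R[i]) : Re (z * t) = Re z * Re t - Im z * Im t.
Proof. by case: z t => ? ? []. Qed.

Lemma cImM (z t : R[i]) : Im (z * t) = Re z * Im t + Im z * Re t.
Proof. by case: z t => ? ? []. Qed.

Lemma cReD (z t : R[i]) : Re (z + t) = Re z + Re t.
Proof. by case: z t => ? ? []. Qed.

Lemma cImD (z t : R[i]) : Im (z + t) = Im z + Im t.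
Proof. by case: z t => ? ? []. Qed.

Lemma Re_conj (z : R[i]) : Re (conjc z) = Re z. Proof. by case: z. Qed.

Lemma Im_conj (z : R[i]) : Im (conjc z) = - Im z. Proof. by case: z. Qed.

Lemma complexP (z t : R[i]) : Re z = Re t -> Im z = Im t -> z = t.
Proof. by case: z t => a b [c e] /= -> ->. Qed.

Lemma normr_Re_le (z : R[i]) : `|Re z| <= normc z.
Proof.
case: z => a b /=; rewrite -sqrtr_sqr; apply: ler_wsqrtr.
by rewrite lerDl sqr_ge0.
Qed.

Lemma normr_Im_le (z : R[i]) : `|Im z| <= normc z.
Proof.
case: z => a b /=; rewrite -sqrtr_sqr; apply: ler_wsqrtr.
by rewrite lerDr sqr_ge0.
Qed.

Lemma normc_ge0 (z : R[i]) : 0 <= normc z.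
Proof. by case: z => a b; exact: sqrtr_ge0. Qed.

Lemma normc_conj (z : R[i]) : normc (conjc z) = normc z.
Proof. by case: z => a b /=; rewrite sqrrN. Qed.

Lemma cmeasurableM F G : cmeasurable F -> cmeasurable G -> cmeasurable (fun x => F x * G x).
Proof.
move=> [F1 F2] [G1 G2]; split.
  rewrite (_ : (fun _ => _) = (fun x => Re (F x) * Re (G x) - Im (F x) * Im (G x))).
    by apply: measurable_funB; apply: measurable_funM.
  by apply/funext => x; rewrite cReM.
rewrite (_ : (fun _ => _) = (fun x => Re (F x) * Im (G x) + Im (F x) * Re (G x))).
  by apply: measurable_funD; apply: measurable_funM.
by apply/funext => x; rewrite cImM.
Qed.

Lemma cmeasurable_conj F : cmeasurable F -> cmeasurable (fun x => conjc (F x)).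
Proof.
move=> [F1 F2]; split; first by under eq_fun do rewrite Re_conj.
by under eq_fun do rewrite Im_conj; exact: measurableT_comp.
Qed.

Lemma cmeasurable_indic (A : set T) : measurable A -> cmeasurable (fun x => (x \in A)%:R).
Proof.
move=> mA; split.
  rewrite (_ : (fun _ => _) = \1_A); first exact: measurable_indic.
  by apply/funext => x; rewrite indicE; case: (x \in A).
rewrite (_ : (fun _ => _) = cst 0); first exact: measurable_cst.
by apply/funext => x; case: (x \in A).
Qed.

Lemma measurable_normc F : cmeasurable F -> measurable_fun setT (fun x => normc (F x)).
Proof.
move=> [F1 F2].
rewrite (_ : (fun _ => _) = (fun x => Num.sqrt (Re (F x) ^+ 2 + Im (F x) ^+ 2))); last first.
  by apply/funext => x; case: (F x).
apply: measurableT_comp (continuous_measurable_fun (@sqrt_continuous R)) _.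
by apply: measurable_funD; exact: measurable_funX.
Qed.

Variable mu : {measure set T -> \bar R}.

Definition cintegrable F : Prop :=
  mu.-integrable setT (fun x => (Re (F x))%:E) /\ mu.-integrable setT (fun x => (Im (F x))%:E).

Definition cint F : R[i] :=
  ((\int[mu]_x Re (F x)) +i* (\int[mu]_x Im (F x)))%C.

Lemma cintegrable_measurable F : cintegrable F -> cmeasurable F.
Proof.
by move=> [/measurable_int F1 /measurable_int F2]; split; apply/measurable_EFinP.
Qed.

Lemma cintegrable_le F (h : T -> R) : cmeasurable F ->
  mu.-integrable setT (fun x => (h x)%:E) -> (forall x, normc (F x) <= h x) -> cintegrable F.
Proof.
move=> [F1 F2] hi Fh.
by split; apply: (le_integrable measurableT _ _ hi);
  rewrite ?measurable_EFinP // => x _; rewrite /= lee_fin; apply: le_trans (le_trans (Fh x) (ler_norm _));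
  rewrite ?normr_Re_le ?normr_Im_le.
Qed.

Lemma cintegrableD F G : cintegrable F -> cintegrable G -> cintegrable (fun x => F x + G x).
Proof.
move=> [F1 F2] [G1 G2]; split.
  by under eq_fun do rewrite cReD EFinD; exact: integrableD.
by under eq_fun do rewrite cImD EFinD; exact: integrableD.
Qed.

Lemma cintegrableZ a F : cintegrable F -> cintegrable (fun x => a * F x).
Proof.
move=> [F1 F2]; split.
  under eq_fun do rewrite cReM EFinB !EFinM.
  by apply: integrableB => //; exact: integrableZl.
under eq_fun do rewrite cImM EFinD !EFinM.
by apply: integrableD => //; exact: integrableZl.
Qed.

Lemma cintegrable0 : cintegrable (fun=> 0).
Proof. by split; exact: integrable0. Qed.

Lemma cintegrable_sum (I : Type) (r : seq I) (P : pred I) (H : I -> T -> R[i]) :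
  (forall i, P i -> cintegrable (H i)) -> cintegrable (fun x => \sum_(i <- r | P i) H i x).
Proof.
move=> hH; elim: r => [|i r IH].
  by under eq_fun do rewrite big_nil; exact: cintegrable0.
under eq_fun do rewrite big_cons.
by case Pi: (P i) => //; apply: cintegrableD => //; exact: hH.
Qed.

Lemma cintegrable_conj F : cintegrable F -> cintegrable (fun x => conjc (F x)).
Proof.
move=> [F1 F2]; split; first by under eq_fun do rewrite Re_conj.
by under eq_fun do rewrite Im_conj EFinN; exact: integrableN.
Qed.

Lemma cintegrable_indic (A : set T) F : measurable A -> cintegrable F ->
  cintegrable (fun x => (x \in A)%:R * F x).
Proof.
move=> mA iF; have [F1 F2] := iF.
(* This majorant is integrable since both parts are, and it dominates the modulus. *)
apply: (@cintegrable_le _ (fun x => `|Re (F x)| + `|Im (F x)|)).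
- by apply: cmeasurableM (cintegrable_measurable iF); exact: cmeasurable_indic.
- under eq_fun do rewrite EFinD.
  by apply: integrableD => //; exact: integrable_norm.
move=> x; apply: (@le_trans _ _ (normc (F x))).
  by rewrite ComplexField.Normc.normcM; case: (x \in A);
    rewrite ?ComplexField.Normc.normc0 ?ComplexField.Normc.normc1 ?mul1r ?mul0r ?normc_ge0.
case: (F x) => a b /=.
rewrite -[leRHS]ger0_norm ?addr_ge0 // -sqrtr_sqr; apply: ler_wsqrtr.
rewrite sqrrD !real_normK ?num_real // addrAC lerDl.
by rewrite mulrn_wge0 // mulr_ge0.
Qed.

Lemma cintD F G : cintegrable F -> cintegrable G ->
  cint (fun x => F x + G x) = cint F + cint G.
Proof.
move=> [F1 F2] [G1 G2]; rewrite /cint.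
under eq_Rintegral do rewrite cReD.
under [X in (_ +i* X)%C]eq_Rintegral do rewrite cImD.
by rewrite !RintegralD.
Qed.

Lemma cintZ a F : cintegrable F -> cint (fun x => a * F x) = a * cint F.
Proof.
move=> [F1 F2].
have hZ k (u : T -> R) : mu.-integrable setT (fun x => (u x)%:E) ->
    mu.-integrable setT (EFin \o (fun x => k * u x)).
  move=> ui; rewrite (_ : EFin \o _ = (fun x => k%:E * (u x)%:E)%E); first exact: integrableZl.
  by apply/funext => x; rewrite /= EFinM.
apply: complexP; rewrite ?cReM ?cImM /=.
  under eq_Rintegral do rewrite cReM.
  by rewrite RintegralB ?RintegralZl //; exact: hZ.
under eq_Rintegral do rewrite cImM.
by rewrite RintegralD ?RintegralZl //; exact: hZ.
Qed.

Lemma cint0 : cint (fun=> 0) = 0.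
Proof. by rewrite /cint; apply: complexP; rewrite /= /Rintegral integral0. Qed.

Lemma cint_sum (I : Type) (r : seq I) (P : pred I) (H : I -> T -> R[i]) :
  (forall i, P i -> cintegrable (H i)) ->
  cint (fun x => \sum_(i <- r | P i) H i x) = \sum_(i <- r | P i) cint (H i).
Proof.
move=> hH; elim: r => [|i r IH].
  by under eq_fun do rewrite big_nil; rewrite big_nil cint0.
under eq_fun do rewrite big_cons.
rewrite big_cons; case Pi: (P i) => //; rewrite cintD ?IH //; first exact: hH.
exact: cintegrable_sum.
Qed.

Lemma cint_conj F : cintegrable F -> cint (fun x => conjc (F x)) = conjc (cint F).
Proof.
move=> [F1 F2]; apply: complexP; rewrite ?Re_conj ?Im_conj /=.
  by under eq_Rintegral do rewrite Re_conj.
under eq_Rintegral do rewrite Im_conj -mulN1r.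
by rewrite RintegralZl // mulN1r.
Qed.

End complex_integral.

Lemma cmeasurable_comp (R : realType) d d' (T : measurableType d) (T' : measurableType d')
    (phi : T' -> T) (F : T -> R[i]) :
  measurable_fun setT phi -> cmeasurable F -> cmeasurable (fun x => F (phi x)).
Proof.
move=> mphi [F1 F2].
by split; [exact: measurableT_comp F1 mphi|exact: measurableT_comp F2 mphi].
Qed.

Section complex_transfer.
Context (R : realType) (d1 d2 d3 : measure_display) (W : measurableType d1)
  (S : measurableType d2) (T : measurableType d3).
Local Notation Re := complex.Re.
Local Notation Im := complex.Im.

Lemma Re_indic (b : bool) (z : R[i]) : Re (b%:R * z) = b%:R * Re z.
Proof. by case: b; rewrite ?mul1r ?mul0r. Qed.

Lemma Im_indic (b : bool) (z : R[i]) : Im (b%:R * z) = b%:R * Im z.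
Proof. by case: b; rewrite ?mul1r ?mul0r. Qed.

Lemma patch_EFin_indic (V : Type) (E : set V) (u : V -> R) :
  (EFin \o u) \_ E = (fun v => ((v \in E)%:R * u v)%:E).
Proof. by apply/funext => v; rewrite patchE /=; case: (v \in E); rewrite ?mul1r ?mul0r. Qed.

(** [cint] always integrates over the whole space; a domain enters as a factor, which keeps sums
    over cells linear. This and the next lemma translate to integrals over a subset. *)
Lemma integrable_indic_mul d (V : measurableType d) (mu : {measure set V -> \bar R})
    (E : set V) (u : V -> R) : measurable E ->
  mu.-integrable setT (fun v => ((v \in E)%:R * u v)%:E) <-> mu.-integrable E (EFin \o u).
Proof. by move=> mE; rewrite (integrable_mkcond _ mE) patch_EFin_indic. Qed.

Lemma Rintegral_indic_mul d (V : measurableType d) (mu : {measure set V -> \bar R})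
    (E : set V) (u : V -> R) :
  \int[mu]_v ((v \in E)%:R * u v) = \int[mu]_(v in E) u v.
Proof. by rewrite [in RHS]/Rintegral integral_mkcond patch_EFin_indic. Qed.

Variables (P : {measure set W -> \bar R}) (nu : {measure set S -> \bar R}).
Variables (X : W -> T) (Y : S -> T) (A : set W) (D : set S) (c : {nonneg R}).
Hypotheses (mX : measurable_fun setT X) (mY : measurable_fun setT Y).
Hypotheses (mA : measurable A) (mD : measurable D).
Hypothesis PXE : forall B, measurable B ->
  P (A `&` X @^-1` B) = (c%:num%:E * nu (D `&` Y @^-1` B))%E.
Variable F : T -> R[i].
Hypothesis mF : cmeasurable F.
Hypothesis iF : cintegrable nu (fun z => (z \in D)%:R * F (Y z)).

Let integrable_part (u : T -> R) : measurable_fun setT u ->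
  nu.-integrable setT (fun z => ((z \in D)%:R * u (Y z))%:E) ->
  P.-integrable setT (fun w => ((w \in A)%:R * u (X w))%:E).
Proof.
move=> mu; rewrite (integrable_indic_mul nu (u \o Y)) // (integrable_indic_mul P (u \o X)) //.
by apply: (integrable_transfer (f := EFin \o u) mX mY mA mD PXE); exact/measurable_EFinP.
Qed.

Let integral_part (u : T -> R) : measurable_fun setT u ->
  nu.-integrable setT (fun z => ((z \in D)%:R * u (Y z))%:E) ->
  \int[P]_w ((w \in A)%:R * u (X w)) = c%:num * \int[nu]_z ((z \in D)%:R * u (Y z)).
Proof.
move=> mu; rewrite (integrable_indic_mul nu (u \o Y)) // => iu.
rewrite (Rintegral_indic_mul P A (u \o X)) (Rintegral_indic_mul nu D (u \o Y)) /Rintegral.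
rewrite (integral_transfer (f := EFin \o u) mX mY mA mD PXE) //; last exact/measurable_EFinP.
by rewrite fineM //; exact: integrable_fin_num.
Qed.

Lemma cintegrable_transfer : cintegrable P (fun w => (w \in A)%:R * F (X w)).
Proof.
case: mF iF => F1 F2 [iF1 iF2]; split.
  under eq_fun do rewrite Re_indic.
  by apply: (integrable_part F1); move: iF1; under eq_fun do rewrite Re_indic.
under eq_fun do rewrite Im_indic.
by apply: (integrable_part F2); move: iF2; under eq_fun do rewrite Im_indic.
Qed.

Lemma cint_transfer : cint P (fun w => (w \in A)%:R * F (X w)) =
  (c%:num)%:C%C * cint nu (fun z => (z \in D)%:R * F (Y z)).
Proof.
case: mF iF => F1 F2 [iF1 iF2]; apply: complexP; rewrite ?cReM ?cImM /= mul0r ?subr0 ?addr0.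
  under eq_Rintegral do rewrite Re_indic.
  under [in RHS]eq_Rintegral do rewrite Re_indic.
  apply: (integral_part F1).
  by move: iF1; under eq_fun do rewrite Re_indic.
under eq_Rintegral do rewrite Im_indic.
under [in RHS]eq_Rintegral do rewrite Im_indic.
apply: (integral_part F2).
by move: iF2; under eq_fun do rewrite Im_indic.
Qed.

End complex_transfer.

Section complex_fubini.
Context (R : realType) (d1 d2 : measure_display) (T1 : measurableType d1)
  (T2 : measurableType d2).
Variables (m1 : {sigma_finite_measure set T1 -> \bar R})
  (m2 : {sigma_finite_measure set T2 -> \bar R}).
Local Notation Re := complex.Re.
Local Notation Im := complex.Im.
Local Notation mm := (m1 \x m2)%E.

(** Tonelli: the iterated integral of |u| |v| is a product of two finite integrals. *)
Let integrable_mul (u : T1 -> R) (v : T2 -> R) :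
  m1.-integrable setT (EFin \o u) -> m2.-integrable setT (EFin \o v) ->
  mm.-integrable setT (fun z => (u z.1 * v z.2)%:E).
Proof.
move=> iu iv; apply/integrable12ltyP.
  apply/measurable_EFinP/measurable_funM.
    by apply: measurableT_comp => //; exact/measurable_EFinP/(measurable_int _ iu).
  by apply: measurableT_comp => //; exact/measurable_EFinP/(measurable_int _ iv).
have /integrableP[mv voo] := iv; have /integrableP[mu' uoo] := iu.
have mabs d (V : measurableType d) (h : V -> R) : measurable_fun setT (EFin \o h) ->
    measurable_fun setT (fun y => `|h y|%:E).
  by move=> /measurable_EFinP mh; apply/measurable_EFinP; exact: measurableT_comp.
under eq_integral => x _.
  under eq_integral => y _ do rewrite /= normrM EFinM.
  rewrite ge0_integralZl_EFin //; last exact: mabs.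
  over.
rewrite ge0_integralZr //; last 2 first.
- exact: mabs.
- exact: integral_ge0.
by apply: lte_mul_pinfty => //; rewrite ?integral_ge0 // ge0_fin_numE // integral_ge0.
Qed.

Let integral_mul (u : T1 -> R) (v : T2 -> R) :
  m1.-integrable setT (EFin \o u) -> m2.-integrable setT (EFin \o v) ->
  \int[mm]_z (u z.1 * v z.2) = (\int[m1]_x u x) * (\int[m2]_y v y).
Proof.
move=> iu iv; rewrite /Rintegral -(integral12_prod_meas1 (integrable_mul iu iv)) /=.
rewrite -fineM; try exact: integrable_fin_num.
congr fine; rewrite /fubini_F /=.
have fv : (\int[m2]_y (v y)%:E)%E \is a fin_num by exact: integrable_fin_num.
rewrite -(fineK fv) -integralZr //; apply: eq_integral => x _ /=.
under eq_integral => y _ do rewrite /= EFinM.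
by rewrite integralZl // fineK.
Qed.

Lemma cintegrable_prod (F : T1 -> R[i]) (G : T2 -> R[i]) :
  cintegrable m1 F -> cintegrable m2 G -> cintegrable mm (fun z => F z.1 * G z.2).
Proof.
move=> [F1 F2] [G1 G2]; split.
  under eq_fun do rewrite cReM EFinB.
  by apply: integrableB => //; [exact: (integrable_mul F1 G1)|exact: (integrable_mul F2 G2)].
under eq_fun do rewrite cImM EFinD.
by apply: integrableD => //; [exact: (integrable_mul F1 G2)|exact: (integrable_mul F2 G1)].
Qed.

Lemma cint_prod (F : T1 -> R[i]) (G : T2 -> R[i]) :
  cintegrable m1 F -> cintegrable m2 G ->
  cint mm (fun z => F z.1 * G z.2) = cint m1 F * cint m2 G.
Proof.
move=> [F1 F2] [G1 G2]; apply: complexP; rewrite ?cReM ?cImM /=.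
  under [LHS]eq_Rintegral do rewrite cReM.
  rewrite RintegralB //; [|exact: (integrable_mul F1 G1)|exact: (integrable_mul F2 G2)].
  by rewrite (integral_mul F1 G1) (integral_mul F2 G2).
under [LHS]eq_Rintegral do rewrite cImM.
rewrite RintegralD //; [|exact: (integrable_mul F1 G2)|exact: (integrable_mul F2 G1)].
by rewrite (integral_mul F1 G2) (integral_mul F2 G1).
Qed.

End complex_fubini.

(** * Cells and the sets D_i *)

Section geometry.
Variables (R : realType) (b m s : nat).
Hypothesis b_prime : prime b.
Local Notation N := (b ^ m)%N.
Local Notation index := {ffun 'I_s -> 'I_N}.
Local Notation leb := (lebesgue_tuple R s).
Local Notation cube := (unit_cube R s).
Let b_gt0 : (0 < b)%N := prime_gt0 b_prime.
Let b_gt1 : (1 < b)%N := prime_gt1 b_prime.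

Definition cell (c : index) : set (s.-tuple R) :=
  [set x | forall j, (c j)%:R / b%:R ^+ m <= tnth x j < (c j).+1%:R / b%:R ^+ m].

Lemma measurable_box (A : 'I_s -> set R) : (forall j, measurable (A j)) ->
  measurable [set x : s.-tuple R | forall j, A j (tnth x j)].
Proof.
move=> mA; rewrite (_ : [set x | _] =
    \big[setI/setT]_(j < s) [set x : s.-tuple R | A j (tnth x j)]).
  apply: bigsetI_measurable => j _; rewrite -[X in measurable X]setTI.
  exact: (@measurable_tnth _ R s j measurableT _ (mA j)).
rewrite -bigcap_seq; apply/seteqP; split=> x /= h j; first by move=> _; exact: h.
by apply: (h j) => /=; rewrite mem_index_enum.
Qed.

Lemma cubeE : cube = [set x | forall j, `[0, 1[%classic (tnth x j)].
Proof. by apply/seteqP; split => x /= h j; have := h j; rewrite in_itv. Qed.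

Lemma cellE (c : index) : cell c =
  [set x | forall j, `[(c j)%:R / b%:R ^+ m, (c j).+1%:R / b%:R ^+ m[%classic (tnth x j)].
Proof. by apply/seteqP; split => x /= h j; have := h j; rewrite in_itv. Qed.

Lemma measurable_cube : measurable cube.
Proof. by rewrite cubeE; apply: (@measurable_box (fun=> `[0, 1[%classic)) => j. Qed.

Lemma measurable_cell c : measurable (cell c).
Proof. rewrite cellE; apply: (@measurable_box (fun j =>
  `[(c j)%:R / b%:R ^+ m, (c j).+1%:R / b%:R ^+ m[%classic)) => j.
exact: measurable_itv. Qed.

Lemma lebesgue_cube : leb cube = 1%E.
Proof.
rewrite cubeE (@lebesgue_tuple_box R s (fun=> `[0, 1[%classic)) // big1 // => j _.
by rewrite lebesgue_measure_itv /= lte_fin ltr01 oppr0 adde0.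
Qed.

Lemma lebesgue_cell c : leb (cell c) = (N%:R^-1 ^+ s)%:E.
Proof.
rewrite cellE (@lebesgue_tuple_box R s (fun j =>
  `[(c j)%:R / b%:R ^+ m, (c j).+1%:R / b%:R ^+ m[%classic)) => [|j]; last exact: measurable_itv.
rewrite (eq_bigr (fun=> (N%:R^-1)%:E)) => [|j _].
  by rewrite prodEFin prodr_const card_ord.
rewrite lebesgue_measure_itv /= lte_fin.
have bm : 0 < b%:R ^+ m :> R by rewrite exprn_gt0 // ltr0n.
rewrite ltr_pM2r ?invr_gt0 // ltr_nat ltnSn -EFinB -mulrBl -natr1 addrAC subrr add0r.
by rewrite mul1r natrX.
Qed.

Lemma cell_truncn c x : cell c x <-> cube x /\ forall j, Num.truncn (b%:R ^+ m * tnth x j) = c j.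
Proof.
have bm : 0 < b%:R ^+ m :> R by rewrite exprn_gt0 // ltr0n.
split => [cx|[cx e] j]; last first.
  by have /andP[x0 _] := cx j; rewrite -truncn_eq_itv // e.
have cux : cube x.
  move=> j; have /andP[h1 h2] := cx j; apply/andP; split.
    by apply: le_trans h1; rewrite divr_ge0 // ltW.
  apply: lt_le_trans h2 _; rewrite ler_pdivrMr // mul1r -natrX ler_nat.
  exact: ltn_ord.
split=> // j; apply/eqP; have /andP[x0 _] := cux j.
by rewrite truncn_eq_itv //; exact: cx.
Qed.

(** The cells partition the cube. The last clause is phrased so that a sum over cells weighted by
    membership reduces to a single term. *)
Lemma cube_cell x : cube x -> exists2 c : index,
  (forall j, Num.truncn (b%:R ^+ m * tnth x j) = c j) & forall c', (x \in cell c') = (c' == c).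
Proof.
move=> cx; pose c : index := [ffun j => Ordinal (truncn_lt_exp m b_gt0 (cx j))].
have ec j : Num.truncn (b%:R ^+ m * tnth x j) = c j by rewrite ffunE.
exists c => // c'; apply/idP/eqP => [/set_mem /cell_truncn [_ e]|->].
  by apply/ffunP => j; apply/val_inj; rewrite /= -e -ec.
by apply/mem_set/cell_truncn.
Qed.

(** As i + 1 <= m, both floors in [common_digits] are determined by the first m digits; for
    nonnegative reals floor and [truncn] agree. *)
Lemma common_digits_prefix (u v : R) (i : nat) : 0 <= u -> 0 <= v -> (i < m)%N ->
  common_digits b u v i <->
    common_prefix b m i (Num.truncn (b%:R ^+ m * u)) (Num.truncn (b%:R ^+ m * v)) &&
    ~~ common_prefix b m i.+1 (Num.truncn (b%:R ^+ m * u)) (Num.truncn (b%:R ^+ m * v)).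
Proof.
move=> u0 v0 im.
have E k : (k <= m)%N -> (Num.floor (b%:R ^+ k * u) == Num.floor (b%:R ^+ k * v)) =
   common_prefix b m k (Num.truncn (b%:R ^+ m * u)) (Num.truncn (b%:R ^+ m * v)).
  move=> km; rewrite /common_prefix -!truncn_prefix // !truncn_floor !mulr_ge0 ?exprn_ge0 //.
  apply/eqP/eqP => [-> //|e].
  by rewrite -[LHS]gez0_abs ?e ?gez0_abs // floor_ge0 mulr_ge0 ?exprn_ge0.
rewrite /common_digits -!E //; last exact: ltnW.
by split => [[/eqP -> /eqP ->]|/andP[/eqP -> /eqP]].
Qed.

Lemma prod_natr_bool (A : pzSemiRingType) (I : finType) (B : pred I) :
  \prod_i (B i)%:R = [forall i, B i]%:R :> A.
Proof.
have [/forallP h|/forallPn[i h]] := boolP [forall i, B i].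
  by apply: big1 => i _; rewrite h.
rewrite (eq_bigr (fun i => ((B i) : nat)%:R)) // -natr_prod (bigD1 i) //=.
by rewrite (negPf h) mul0n.
Qed.

Lemma exact_prefixE i c c' : (i < m)%N -> exact_prefix R b m i c c' =
  (common_prefix b m i c c' && ~~ common_prefix b m i.+1 c c')%:R.
Proof.
move=> im; rewrite /exact_prefix; have [p|np] := boolP (common_prefix b m i.+1 c c').
  by rewrite (common_prefix_le b_gt0 _ im p) // subrr.
by rewrite subr0 andbT.
Qed.

Lemma digit_set_indic (i : {ffun 'I_s -> nat}) (x y : s.-tuple R) :
  (forall j, (i j < m)%N) ->
  ((x, y) \in digit_set R b i)%:R = \sum_(c : index) \sum_(c' : index)
    (\prod_j exact_prefix R b m (i j) (c j) (c' j))%:C%C *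
      ((x \in cell c)%:R * (y \in cell c')%:R) :> R[i].
Proof.
move=> im.
have [xc|nx] := boolP (x \in cube); last first.
  rewrite big1 => [|c _].
    by rewrite (_ : _ \in _ = false) //; apply/negP => /set_mem[/= h _ _]; rewrite (mem_set h) in nx.
  apply: big1 => c' _; rewrite (_ : x \in cell c = false) ?mul0r ?mulr0 //.
  by apply/negP => /set_mem/cell_truncn[h _]; rewrite (mem_set h) in nx.
have [yc|ny] := boolP (y \in cube); last first.
  rewrite big1 => [|c _].
    by rewrite (_ : _ \in _ = false) //; apply/negP => /set_mem[/= _ h _]; rewrite (mem_set h) in ny.
  apply: big1 => c' _; rewrite (_ : y \in cell c' = false) ?mulr0 //.
  by apply/negP => /set_mem/cell_truncn[h _]; rewrite (mem_set h) in ny.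
move/set_mem in xc; move/set_mem in yc.
have [c ec hc] := cube_cell xc; have [c' ec' hc'] := cube_cell yc.
rewrite (bigD1 c) //= [X in _ + X]big1 ?addr0 => [|e /negPf ne]; last first.
  by apply: big1 => e' _; rewrite hc ne mul0r mulr0.
rewrite (bigD1 c') //= [X in _ + X]big1 ?addr0 => [|e /negPf ne]; last first.
  by rewrite hc' ne !mulr0.
rewrite hc hc' !eqxx !mulr1.
under eq_bigr => j _ do rewrite exact_prefixE //.
rewrite prod_natr_bool realc_nat; congr (_%:R); congr nat_of_bool.
apply/idP/forallP => [/set_mem[_ _ h] j|h]; last first.
  by apply/mem_set; split => // j; rewrite common_digits_prefix ?ec ?ec'; [|case/andP: (xc j)|case/andP: (yc j)|].
have := h j; rewrite common_digits_prefix ?ec ?ec' //; first by case/andP: (xc j).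
by case/andP: (yc j).
Qed.

Lemma real_digit_cell (v : R) (i : nat) : 0 <= v -> (i < m)%N ->
  real_digit b v i.+1 = cell_digit b m (Num.truncn (b%:R ^+ m * v)) i.
Proof. by move=> v0 im; rewrite /real_digit /cell_digit (@truncn_prefix _ b m). Qed.

Lemma wal1_cell (l : nat) (v : R) : (l < N)%N -> 0 <= v ->
  wal1 b l v = cell_wal R b m l (Num.truncn (b%:R ^+ m * v)).
Proof.
move=> lN v0; rewrite /wal1 /cell_wal; congr (_ ^+ _).
rewrite -(big_mkord predT (fun i => nat_digit b l i * real_digit b v i.+1)%N).
rewrite -(big_mkord predT (fun i => nat_digit b l i * cell_digit b m (Num.truncn (b%:R ^+ m * v)) i)%N).
have trunc n k F : (n <= k)%N -> (l < b ^ n)%N ->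
    (\sum_(0 <= i < k) nat_digit b l i * F i = \sum_(0 <= i < n) nat_digit b l i * F i)%N.
  move=> nk ln; rewrite (big_cat_nat (leq0n n) nk) /=.
  rewrite [X in (_ + X)%N]big_nat_cond [X in (_ + X)%N]big1 ?addn0 // => i /andP[/andP[ni _] _].
  by rewrite nat_digit_small // (leq_trans ln) // leq_pexp2l.
have ll : (l < b ^ l)%N by exact: ltn_expl.
(* The exponent in [wal1] runs up to l, the one in [cell_wal] up to m. From l < b^l and l < b^m the
   digits of l vanish beyond either bound, so both sums can be cut at the smaller one. *)
transitivity (\sum_(0 <= i < minn l m) nat_digit b l i * real_digit b v i.+1)%N.
  by apply: trunc; [|rewrite /minn; case: ifP]; rewrite ?geq_minl ?geq_minr.
transitivity (\sum_(0 <= i < minn l m) nat_digit b l i * cell_digit b m (Num.truncn (b%:R ^+ m * v)) i)%N.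
  rewrite big_nat [RHS]big_nat; apply: eq_bigr => i /= im.
  by rewrite real_digit_cell // (leq_trans im) // geq_minr.
by apply/esym; apply: trunc; [|rewrite /minn; case: ifP]; rewrite ?geq_minl ?geq_minr.
Qed.

Lemma wal_cell (l c : index) (x : s.-tuple R) : cell c x ->
  wal b [ffun j => (l j : nat)] x = cell_walsh R l c.
Proof.
move=> /cell_truncn [xc e]; apply: eq_bigr => j _.
by rewrite ffunE wal1_cell ?e //; case/andP: (xc j).
Qed.

End geometry.

(** As every k_j <= m, the set L_k consists of indices below b^m, so the sum over a set of naturals
    becomes a sum over a finite type. *)
Lemma sigma2E (R : realType) (b m s : nat) (f : s.-tuple R -> R[i]) (k : {ffun 'I_s -> nat}) :
  prime b -> (forall j, (k j <= m)%N) ->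
  sigma2 b f k = \sum_(l : {ffun 'I_s -> 'I_(b ^ m)} | [forall j, num_digits b (l j) == k j])
    ComplexField.Normc.normc (walsh_coef b f [ffun j => (l j : nat)]) ^+ 2.
Proof.
move=> b_prime km; have b1 := prime_gt1 b_prime.
pose h (l : {ffun 'I_s -> 'I_(b ^ m)}) : {ffun 'I_s -> nat} := [ffun j => (l j : nat)].
have h_inj : injective h.
  move=> l l' /ffunP e; apply/ffunP => j; apply/val_inj.
  by have := e j; rewrite !ffunE.
pose r := [seq h l | l <- enum [pred l : {ffun 'I_s -> 'I_(b ^ m)} |
  [forall j, num_digits b (l j) == k j]]].
rewrite /sigma2; have -> : walsh_block b k = [set` r].
  apply/seteqP; split => [l hl|l /= /mapP[l' + ->]] /=; last first.
    rewrite mem_enum inE => /forallP hl' j.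
    by rewrite ffunE -num_digits_eq //; exact: hl'.
  have lt j : (l j < b ^ m)%N.
    have /andP[_ lj] := hl j; apply: leq_trans lj _.
    by apply: leq_pexp2l; [exact: ltnW|exact: km].
  apply/mapP; exists [ffun j => Ordinal (lt j)].
    by rewrite mem_enum inE; apply/forallP => j; rewrite ffunE num_digits_eq //; exact: hl.
  by apply/ffunP => j; rewrite !ffunE.
rewrite -fsbig_seq; last by rewrite map_inj_uniq // enum_uniq.
by rewrite big_map big_enum; apply: eq_bigl => l; rewrite inE.
Qed.

(** * The function [f] extended by zero and its Walsh coefficients *)

Section cube_function.
Context (R : realType) (s : nat).
Variable f : s.-tuple R -> R[i].
Hypothesis f_L2 : square_integrable f.
Local Notation leb := (lebesgue_tuple R s).
Local Notation cube := (unit_cube R s).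
Local Notation normc := ComplexField.Normc.normc.
Local Notation Re := complex.Re.
Local Notation Im := complex.Im.

(** [f] is only assumed measurable on the cube; the extension by zero is measurable everywhere, as
    change of variables requires, and agrees with [f] at all sample points. *)
Definition on_cube (x : s.-tuple R) : R[i] := (x \in cube)%:R * f x.

Lemma on_cube_in x : cube x -> on_cube x = f x.
Proof. by move=> cx; rewrite /on_cube mem_set // mul1r. Qed.

Lemma cmeasurable_on_cube : cmeasurable on_cube.
Proof.
case: f_L2 => f1 f2 _; split.
  under eq_fun do rewrite /on_cube Re_indic.
  move/(measurable_restrictT _ (@measurable_cube R s)): f1; congr (measurable_fun _ _).
  by apply/funext => x; rewrite patchE; case: ifP; rewrite ?mul1r ?mul0r.
under eq_fun do rewrite /on_cube Im_indic.
move/(measurable_restrictT _ (@measurable_cube R s)): f2; congr (measurable_fun _ _).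
by apply/funext => x; rewrite patchE; case: ifP; rewrite ?mul1r ?mul0r.
Qed.

Lemma integrable_normc2_on_cube : leb.-integrable setT (fun x => (normc (on_cube x) ^+ 2)%:E).
Proof.
case: f_L2 => _ _ foo; apply/integrableP; split.
  apply/measurable_EFinP; apply: measurable_funX.
  exact: measurable_normc cmeasurable_on_cube.
apply: le_lt_trans foo; rewrite [leRHS]integral_mkcond le_eqVlt; apply/orP; left; apply/eqP.
apply: eq_integral => x _; rewrite gee0_abs ?lee_fin ?sqr_ge0 // patchE.
rewrite /on_cube ComplexField.Normc.normcM; case: ifP => _.
  by rewrite ComplexField.Normc.normc1 mul1r.
by rewrite ComplexField.Normc.normc0 mul0r expr0n.
Qed.

Lemma integrable_cube : leb.-integrable setT (fun x => ((x \in cube)%:R)%:E).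
Proof.
have -> : (fun x => ((x \in cube)%:R)%:E) = EFin \o \1_cube :> (_ -> \bar R).
  by apply/funext => x; rewrite /= indicE.
apply/integrableP; split.
  by apply/measurable_EFinP; apply: measurable_indic; exact: measurable_cube.
under eq_integral do rewrite /= ger0_norm //.
rewrite integral_indic ?setIT //; last exact: measurable_cube.
by rewrite [X in (X < _)%E]lebesgue_cube ltry.
Qed.

Lemma cintegrable_on_cube : cintegrable leb on_cube.
Proof.
(* Square integrable implies integrable on a set of finite measure, through |f| <= |f|^2 + 1. *)
apply: (@cintegrable_le _ _ _ _ _ (fun x => normc (on_cube x) ^+ 2 + (x \in cube)%:R)).
- exact: cmeasurable_on_cube.
- under eq_fun do rewrite EFinD.
  by apply: integrableD => //; [exact: integrable_normc2_on_cube|exact: integrable_cube].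
move=> x; rewrite /on_cube ComplexField.Normc.normcM; case: (x \in cube).
  rewrite ComplexField.Normc.normc1 mul1r mulr1n.
  by have := normc_ge0 (f x); nra.
by rewrite ComplexField.Normc.normc0 mul0r expr0n addr0.
Qed.

Lemma cube_integralE (h : s.-tuple R -> R[i]) :
  cube_integral h = cint leb (fun x => (x \in cube)%:R * h x).
Proof.
apply: complexP => /=.
  by under [RHS]eq_Rintegral do rewrite Re_indic; rewrite Rintegral_indic_mul.
by under [RHS]eq_Rintegral do rewrite Im_indic; rewrite Rintegral_indic_mul.
Qed.

Variables (b m : nat).
Hypothesis b_prime : prime b.
Local Notation N := (b ^ m)%N.
Local Notation index := {ffun 'I_s -> 'I_N}.

Definition cell_integral (c : index) : R[i] := cint leb (fun x => (x \in cell c)%:R * on_cube x).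

(** Exact, not an approximation: a Walsh function of index below b^m is constant on every cell. *)
Lemma walsh_coefE (l : index) :
  walsh_coef b f [ffun j => (l j : nat)] = cell_coef cell_integral l.
Proof.
rewrite /walsh_coef cube_integralE /cell_coef.
have E x : (x \in cube)%:R * (f x * conjc (wal b [ffun j => (l j : nat)] x)) =
    \sum_(c : index) conjc (cell_walsh R l c) * ((x \in cell c)%:R * on_cube x).
  have [xc|nx] := boolP (x \in cube); last first.
    by rewrite mul0r big1 // => c _; rewrite /on_cube (negPf nx) mul0r !mulr0.
  have [c ec hc] := cube_cell m b_prime (set_mem xc).
  rewrite (bigD1 c) //= big1 ?addr0 => [|c' /negPf nc]; last by rewrite hc nc mul0r mulr0.
  have cc : cell c x by apply/set_mem; rewrite hc.
  rewrite hc eqxx on_cube_in; last exact: set_mem.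
  by rewrite mulr1n !mul1r (wal_cell b_prime l cc) mulrC.
rewrite (funext E).
have ci (c : index) : cintegrable leb (fun x => (x \in cell c)%:R * on_cube x).
  by apply: cintegrable_indic; [exact: measurable_cell|exact: cintegrable_on_cube].
rewrite cint_sum => [|c _]; last exact: cintegrableZ.
by apply: eq_bigr => c _; rewrite cintZ // mulrC.
Qed.

End cube_function.

Lemma cint_indic (R : realType) d (T : measurableType d) (mu : {measure set T -> \bar R})
    (E : set T) : measurable E ->
  cint mu (fun x => (x \in E)%:R) = (fine (mu E))%:C%C.
Proof.
move=> mE; apply: complexP => /=; last first.
  rewrite /Rintegral (eq_integral (fun=> 0%E)) ?integral0 // => x _.
  by case: (x \in E).
rewrite /Rintegral -[E in RHS]setIT -integral_indic //; congr fine; apply: eq_integral => x _.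
by rewrite indicE; case: (x \in E).
Qed.

Section uniform_transfer.
Context (R : realType) (d d' : measure_display) (Omega : measurableType d)
  (T : measurableType d') (P : probability Omega R) (mu : {measure set T -> \bar R}).
Variables (D : set T) (X : Omega -> T) (F : T -> R[i]).
Hypotheses (mD : measurable D) (muD_fin : (mu D < +oo)%E) (mX : measurable_fun setT X).
Hypothesis X_unif : uniform_on P mu D X.
Hypotheses (mF : cmeasurable F) (iF : cintegrable mu (fun t => (t \in D)%:R * F t)).

Let c_ge0 : 0 <= (fine (mu D))^-1.
Proof. by rewrite invr_ge0 fine_ge0. Qed.

Let PXE B : measurable B ->
  P (setT `&` X @^-1` B) = ((NngNum c_ge0)%:num%:E * mu (D `&` idfun @^-1` B))%E.
Proof.
move=> mB; rewrite setTI X_unif // [in LHS]setIC /= mulrC EFinM fineK //.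
rewrite ge0_fin_numE //; apply: le_lt_trans muD_fin; apply: le_measure; rewrite ?inE //.
exact: measurableI.
Qed.

Lemma cintegrable_uniform : cintegrable P (fun w => F (X w)).
Proof.
have := cintegrable_transfer mX (@measurable_id _ _ setT) measurableT mD PXE mF iF.
by under eq_fun do rewrite in_setT mul1r.
Qed.

Lemma cint_uniform : cint P (fun w => F (X w)) =
  ((fine (mu D))^-1)%:C%C * cint mu (fun t => (t \in D)%:R * F t).
Proof.
have := cint_transfer mX (@measurable_id _ _ setT) measurableT mD PXE mF iF.
move=> /= <-; congr (cint _ _); apply/funext => w.
by rewrite in_setT mul1r.
Qed.

End uniform_transfer.

(** * Integrals over D_i *)

Section digit_set_integral.
Context (R : realType) (b m s : nat).
Hypothesis b_prime : prime b.
Local Notation N := (b ^ m)%N.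
Local Notation index := {ffun 'I_s -> 'I_N}.
Local Notation leb := (lebesgue_tuple R s).
Local Notation cube := (unit_cube R s).
Local Notation mm := (lebesgue_tuple R s \x lebesgue_tuple R s)%E.
Variable i : {ffun 'I_s -> nat}.
Hypothesis im : forall j, (i j < m)%N.
Local Notation D := (digit_set R b i).

Let expand (h : s.-tuple R -> R[i]) :
  (fun z => (z \in D)%:R * (h z.1 * conjc (h z.2))) =
  (fun z => \sum_(c : index) \sum_(c' : index)
    (\prod_j exact_prefix R b m (i j) (c j) (c' j))%:C%C *
      (((z.1 \in cell c)%:R * h z.1) * conjc ((z.2 \in cell c')%:R * h z.2))).
Proof.
apply/funext => -[x y] /=; rewrite (digit_set_indic b_prime x y im) mulr_suml.
apply: eq_bigr => c _; rewrite mulr_suml; apply: eq_bigr => c' _.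
by rewrite conjcM conjc_nat -mulrA [in RHS]mulrACA.
Qed.

Lemma cintegrable_digit_set (h : s.-tuple R -> R[i]) : cintegrable leb h ->
  cintegrable mm (fun z => (z \in D)%:R * (h z.1 * conjc (h z.2))).
Proof.
move=> ih; rewrite expand.
apply: cintegrable_sum => c _; apply: cintegrable_sum => c' _; apply: cintegrableZ.
apply: (cintegrable_prod (F := fun x => (x \in cell c)%:R * h x)
  (G := fun y => conjc ((y \in cell c')%:R * h y))).
  by apply: cintegrable_indic => //; exact: measurable_cell.
by apply: cintegrable_conj; apply: cintegrable_indic => //; exact: measurable_cell.
Qed.

Lemma cint_digit_set (h : s.-tuple R -> R[i]) : cintegrable leb h ->
  cint mm (fun z => (z \in D)%:R * (h z.1 * conjc (h z.2))) =
  \sum_(c : index) \sum_(c' : index)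
    (\prod_j exact_prefix R b m (i j) (c j) (c' j))%:C%C *
      (cint leb (fun x => (x \in cell c)%:R * h x) *
       conjc (cint leb (fun x => (x \in cell c')%:R * h x))).
Proof.
move=> ih; rewrite expand.
have ic (c : index) : cintegrable leb (fun x => (x \in cell c)%:R * h x).
  by apply: cintegrable_indic => //; exact: measurable_cell.
have icc (c c' : index) : cintegrable mm (fun z =>
    ((z.1 \in cell c)%:R * h z.1) * conjc ((z.2 \in cell c')%:R * h z.2)).
  apply: (cintegrable_prod (F := fun x => (x \in cell c)%:R * h x)
    (G := fun y => conjc ((y \in cell c')%:R * h y))) => //.
  exact: cintegrable_conj.
rewrite cint_sum => [|c _]; last by apply: cintegrable_sum => c' _; exact: cintegrableZ.
apply: eq_bigr => c _; rewrite cint_sum => [|c' _]; last exact: cintegrableZ.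
apply: eq_bigr => c' _; rewrite cintZ //; congr (_ * _).
rewrite (cint_prod (F := fun x => (x \in cell c)%:R * h x)
    (G := fun y => conjc ((y \in cell c')%:R * h y))) ?cint_conj //.
exact: cintegrable_conj.
Qed.

(** With this choice of [h] the integral over D_i becomes its volume, and the integrability lemma
    also yields measurability and finite measure of D_i. *)
Let one_cube (x : s.-tuple R) : R[i] := (x \in cube)%:R.

Let cintegrable_one_cube : cintegrable leb one_cube.
Proof.
split; last first.
  rewrite (_ : (fun _ => _) = (fun=> 0%E)); first exact: integrable0.
  by apply/funext => x; rewrite /one_cube; case: (x \in cube).
have := integrable_cube R s; congr (_.-integrable _ _); apply/funext => x.
by rewrite /one_cube; case: (x \in cube).
Qed.

Let digit_set_one : (fun z => (z \in D)%:R * (one_cube z.1 * conjc (one_cube z.2))) =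
  (fun z => (z \in D)%:R).
Proof.
apply/funext => z; have [/set_mem[h1 h2 _]|_] := boolP (z \in D); last by rewrite mul0r.
by rewrite /one_cube !mem_set // conjc1 !mulr1.
Qed.

Lemma cintegrable_digit_set_indic : cintegrable mm (fun z => (z \in D)%:R).
Proof. by rewrite -digit_set_one; exact: cintegrable_digit_set. Qed.

(** D_i is the preimage of 1 under its own indicator, already known to be measurable as a finite sum
    over pairs of cells. *)
Lemma measurable_digit_set : measurable D.
Proof.
have [mD _] := cintegrable_measurable cintegrable_digit_set_indic.
have := mD measurableT [set 1] (measurable_set1 1); rewrite setTI.
congr measurable; apply/seteqP; split => z /= => [|Dz]; last by rewrite mem_set.
by case: (boolP (z \in D)) => [/set_mem //|_] /= /eqP; rewrite eq_sym oner_eq0.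
Qed.

Lemma digit_set_fin : (mm D < +oo)%E.
Proof.
have [/integrableP[_] +  _] := cintegrable_digit_set_indic.
rewrite -[X in mm X]setIT -integral_indic //; last exact: measurable_digit_set.
apply: le_lt_trans; rewrite le_eqVlt; apply/orP; left; apply/eqP.
by apply: eq_integral => z _; rewrite indicE; case: (z \in D); rewrite /= ?normr1 ?normr0.
Qed.

(** Every cell has volume N^-s, so the count of pairs of cells in [sum_exact_prefix] is multiplied
    by N^(-2s), which cancels its factor N^2 per coordinate. *)
Lemma digit_set_volume : fine (mm D) = \prod_j (b%:R ^- i j * (1 - b%:R^-1)).
Proof.
apply: complexI; rewrite -cint_indic; last exact: measurable_digit_set.
rewrite -digit_set_one cint_digit_set //.
have vol (c : index) : cint leb (fun x => (x \in cell c)%:R * one_cube x) = (N%:R^-1 ^+ s)%:C%C.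
  have -> : (fun x => (x \in cell c)%:R * one_cube x) = (fun x => (x \in cell c)%:R).
    apply/funext => x; have [/set_mem/(cell_truncn b_prime)[h _]|_] := boolP (x \in cell c).
      by rewrite /one_cube mem_set // mulr1.
    by rewrite mul0r.
  by rewrite cint_indic ?[X in fine X](lebesgue_cell R b_prime c) //; exact: measurable_cell.
transitivity ((\sum_(c : index) \sum_(c' : index)
    (\prod_j exact_prefix R b m (i j) (c j) (c' j)) * (N%:R^-1 ^+ s * N%:R^-1 ^+ s))%:C%C).
  rewrite realc_sum; apply: eq_bigr => c _; rewrite realc_sum; apply: eq_bigr => c' _.
  by rewrite !vol conjc_real -!realcM.
rewrite (eq_bigr (fun c : index => (\sum_(c' : index) \prod_j exact_prefix R b m (i j) (c j) (c' j)) *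
  (N%:R^-1 ^+ s * N%:R^-1 ^+ s))) => [|c _]; last by rewrite mulr_suml.
rewrite -mulr_suml (sum_exact_prefix R b_prime im).
congr (_%:C%C); rewrite big_split /= prodr_const card_ord mulrAC.
rewrite (_ : _ * (N%:R^-1 ^+ s * N%:R^-1 ^+ s) = 1) ?mul1r //.
have N0 : N%:R != 0 :> R by rewrite pnatr_eq0 -lt0n expn_gt0 prime_gt0.
by rewrite -exprMn -exprMn expr2 -invfM mulfV ?expr1n // mulf_neq0.
Qed.

End digit_set_integral.

(** * Moments of the estimators *)

Section moments.
Context (R : realType) (d : measure_display) (Omega : measurableType d)
  (P : probability Omega R).
Implicit Types Y Z : Omega -> R[i].

Lemma cexpectationE Z : cexpectation P Z = cint P Z.
Proof. by rewrite /cexpectation unlock. Qed.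

Lemma cintegrable_cst (a : R[i]) : cintegrable P (fun=> a).
Proof. by split; exact: finite_measure_integrable_cst. Qed.

Lemma cint_cst (a : R[i]) : cint P (fun=> a) = a.
Proof.
have P1 : fine (P setT) = 1 by rewrite probability_setT.
by apply: complexP; rewrite /= Rintegral_cst // P1 mulr1.
Qed.

Lemma cintegrable_center Y Z (a e : R[i]) : cintegrable P Y -> cintegrable P Z ->
  cintegrable P (fun w => Y w * conjc (Z w)) ->
  cintegrable P (fun w => (Y w - a) * conjc (Z w - e)).
Proof.
move=> iY iZ iYZ.
rewrite (_ : (fun _ => _) = (fun w => Y w * conjc (Z w) +
  ((- conjc e) * Y w + ((- a) * conjc (Z w) + a * conjc e)))); last first.
  by apply/funext => w; rewrite conjcB; ring.
apply: cintegrableD => //; apply: cintegrableD; first exact: cintegrableZ.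
apply: cintegrableD; last exact: cintegrable_cst.
by apply: cintegrableZ; exact: cintegrable_conj.
Qed.

Lemma cint_center Y Z : cintegrable P Y -> cintegrable P Z ->
  cintegrable P (fun w => Y w * conjc (Z w)) ->
  cint P (fun w => (Y w - cint P Y) * conjc (Z w - cint P Z)) =
  cint P (fun w => Y w * conjc (Z w)) - cint P Y * conjc (cint P Z).
Proof.
move=> iY iZ iYZ; set a := cint P Y; set e := cint P Z.
rewrite (_ : (fun _ => _) = (fun w => Y w * conjc (Z w) +
  ((- conjc e) * Y w + ((- a) * conjc (Z w) + a * conjc e)))); last first.
  by apply/funext => w; rewrite conjcB; ring.
have i1 : cintegrable P (fun w => (- conjc e) * Y w) by exact: cintegrableZ.
have i2 : cintegrable P (fun w => (- a) * conjc (Z w)).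
  by apply: cintegrableZ; exact: cintegrable_conj.
have i3 := cintegrable_cst (a * conjc e).
rewrite cintD //; last by apply: cintegrableD => //; exact: cintegrableD.
rewrite cintD //; last exact: cintegrableD.
have iZc := cintegrable_conj iZ; rewrite cintD // !cintZ //; last exact: cintegrable_cst.
by rewrite cint_cst cint_conj // -/a -/e; ring.
Qed.

Lemma ccovarianceE Y Z : cintegrable P Y -> cintegrable P Z ->
  cintegrable P (fun w => Y w * conjc (Z w)) ->
  ccovariance P Y Z = cint P (fun w => Y w * conjc (Z w)) - cint P Y * conjc (cint P Z).
Proof. by move=> iY iZ iYZ; rewrite /ccovariance !cexpectationE cint_center. Qed.

Lemma cvarianceE Z : cintegrable P Z -> cintegrable P (fun w => Z w * conjc (Z w)) ->
  cvariance P Z =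
  (complex.Re (cint P (fun w => Z w * conjc (Z w)) - cint P Z * conjc (cint P Z)))%:E.
Proof.
move=> iZ iZZ; rewrite -cint_center //= /cvariance unlock cexpectationE.
have [i1 _] := cintegrable_center (cint P Z) (cint P Z) iZ iZ iZZ.
rewrite /Rintegral fineK; last exact: (integrable_fin_num measurableT i1).
by apply: eq_integral => w _; rewrite mulc_conj.
Qed.

End moments.

Section sample_mean_variance.
Context (R : realType) (d : measure_display) (Omega : measurableType d)
  (P : probability Omega R) (n s : nat) (f : s.-tuple R -> R[i]).
Variables (X : 'I_n -> Omega -> s.-tuple R) (mean : R[i]).
Hypothesis n_gt0 : (0 < n)%N.
Hypothesis iX : forall l, cintegrable P (fun w => f (X l w)).
Hypothesis iXX : forall l j, cintegrable P (fun w => f (X l w) * conjc (f (X j w))).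
Hypothesis meanX : forall l, cint P (fun w => f (X l w)) = mean.

(** Stated without any assumption on the joint law beyond integrability, so that it applies to the
    net and to Monte Carlo alike and reduces their comparison to second moments of pairs. *)
Lemma cvariance_sample_mean : cvariance P (sample_mean f X) =
  ((n%:R ^- 2 * \sum_l \sum_j complex.Re (cint P (fun w => f (X l w) * conjc (f (X j w)))))
     - complex.Re (mean * conjc mean))%:E.
Proof.
have n0 : n%:R != 0 :> R[i] by rewrite pnatr_eq0 -lt0n.
have E : (fun w => sample_mean f X w * conjc (sample_mean f X w)) =
    (fun w => (n%:R ^- 2)%:C%C * \sum_l \sum_j f (X l w) * conjc (f (X j w))).
  apply/funext => w; rewrite /sample_mean conjcM conjc_sum mulrACA; congr (_ * _).
    rewrite conjc_inv conjc_nat -invfM -expr2.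
    by rewrite fmorphV rmorphXn /= realc_nat.
  by rewrite mulr_suml; apply: eq_bigr => l _; rewrite mulr_sumr.
have iS : cintegrable P (sample_mean f X).
  by apply: cintegrableZ; apply: cintegrable_sum => l _.
have iSS : cintegrable P (fun w => \sum_l \sum_j f (X l w) * conjc (f (X j w))).
  by apply: cintegrable_sum => l _; apply: cintegrable_sum => j _.
have -> : cvariance P (sample_mean f X) = (complex.Re (cint P (fun w =>
    sample_mean f X w * conjc (sample_mean f X w)) - mean * conjc mean))%:E.
  have meanS : cint P (sample_mean f X) = mean.
    rewrite /sample_mean cintZ; last exact: cintegrable_sum.
    rewrite cint_sum // (eq_bigr (fun=> mean)) => [|l _]; last exact: meanX.
    by rewrite sumr_const card_ord -[mean *+ n]mulr_natl mulrA mulVf ?mul1r.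
  by rewrite cvarianceE // ?meanS // E; exact: cintegrableZ.
rewrite E cintZ // cint_sum => [|l _]; last exact: cintegrable_sum.
rewrite cReD; congr (_%:E); congr (_ + _); last by case: (mean * _).
rewrite cReM /= mul0r subr0; congr (_ * _); rewrite (raddf_sum (@complex.Re R)).
by apply: eq_bigr => l _; rewrite cint_sum // (raddf_sum (@complex.Re R)).
Qed.

End sample_mean_variance.

(** * Moments of one and of two sample points *)

Section point_laws.
Context (R : realType) (s : nat) (d : measure_display) (Omega : measurableType d)
  (P : probability Omega R) (f : s.-tuple R -> R[i]).
Hypothesis f_L2 : square_integrable f.
Local Notation leb := (lebesgue_tuple R s).
Local Notation cube := (unit_cube R s).
Local Notation normc := ComplexField.Normc.normc.
Local Notation g := (on_cube f).

Section one_point.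
Variable X : {RV P >-> s.-tuple R}.
Hypothesis X_unif : uniform_cube P X.

Let gX w : g (X w) = f (X w).
Proof. by case: X_unif => /(_ w) cX _; rewrite on_cube_in. Qed.

Let cube_lty : (leb cube < +oo)%E.
Proof. by rewrite lebesgue_cube ltry. Qed.

Let transfer (F : s.-tuple R -> R[i]) : cmeasurable F ->
  cintegrable leb (fun x => (x \in cube)%:R * F x) ->
  cintegrable P (fun w => F (X w)) /\
  cint P (fun w => F (X w)) = cint leb (fun x => (x \in cube)%:R * F x).
Proof.
move=> mF iF; have mX : measurable_fun setT X by [].
have := cint_uniform (@measurable_cube R s) cube_lty mX X_unif.2 mF iF.
rewrite [X in fine X]lebesgue_cube invr1 mul1r.
by split => //; exact: (cintegrable_uniform (@measurable_cube R s) cube_lty mX X_unif.2 mF iF).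
Qed.

Let cube_on_cube x : (x \in cube)%:R * g x = g x.
Proof. by rewrite /on_cube; case: (x \in cube); rewrite ?mul1r ?mul0r. Qed.

Let on_cube_transfer : cintegrable P (fun w => f (X w)) /\
  cint P (fun w => f (X w)) = cube_integral f.
Proof.
have [] := @transfer g (cmeasurable_on_cube f_L2).
  by rewrite (funext cube_on_cube); exact: cintegrable_on_cube.
by rewrite (funext gX) (funext cube_on_cube) cube_integralE.
Qed.

Lemma cintegrable_point : cintegrable P (fun w => f (X w)).
Proof. exact: on_cube_transfer.1. Qed.

Lemma cint_point : cint P (fun w => f (X w)) = cube_integral f.
Proof. exact: on_cube_transfer.2. Qed.

Let square x : R[i] := (normc (g x) ^+ 2)%:C%C.

Let square_transfer : cintegrable P (fun w => square (X w)) /\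
  cint P (fun w => square (X w)) = cint leb (fun x => (x \in cube)%:R * square x).
Proof.
have i2 := integrable_normc2_on_cube f_L2.
have isq : cintegrable leb square.
  by split => //=; exact: integrable0.
apply: transfer; first exact: cintegrable_measurable isq.
by apply: cintegrable_indic => //; exact: measurable_cube.
Qed.

(** The right-hand side does not involve [X]: the diagonal terms of the two variances coincide. *)
Lemma cint_point_square : cint P (fun w => f (X w) * conjc (f (X w))) =
  cint leb (fun x => (x \in cube)%:R * (normc (g x) ^+ 2)%:C%C).
Proof.
rewrite -square_transfer.2; congr (cint _ _); apply/funext => w.
by rewrite mulc_conj -gX.
Qed.

Lemma integrable_normc2_point : P.-integrable setT (fun w => (normc (f (X w)) ^+ 2)%:E).
Proof. by have [[+ _] _] := square_transfer; under eq_fun do rewrite /= gX. Qed.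

End one_point.

Lemma cintegrable_point_mul (X Y : {RV P >-> s.-tuple R}) :
  uniform_cube P X -> uniform_cube P Y ->
  cintegrable P (fun w => f (X w) * conjc (f (Y w))).
Proof.
move=> uX uY.
apply: (@cintegrable_le _ _ _ _ _ (fun w => normc (f (X w)) ^+ 2 + normc (f (Y w)) ^+ 2)).
- apply: cmeasurableM; first exact: cintegrable_measurable (cintegrable_point uX).
  by apply: cmeasurable_conj; exact: cintegrable_measurable (cintegrable_point uY).
- under eq_fun do rewrite EFinD.
  by apply: integrableD => //; exact: integrable_normc2_point.
move=> w; rewrite ComplexField.Normc.normcM normc_conj.
by have := normc_ge0 (f (X w)); have := normc_ge0 (f (Y w)); nra.
Qed.

(** By uniqueness of the product measure, agreement on rectangles makes the joint law the product of
    the laws; the integral then factors by Fubini. *)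
Lemma cint_point_mul_indep (X Y : {RV P >-> s.-tuple R}) :
  uniform_cube P X -> uniform_cube P Y ->
  (forall A B, measurable A -> measurable B ->
    P ((X @^-1` A) `&` (Y @^-1` B)) = (P (X @^-1` A) * P (Y @^-1` B))%E) ->
  cint P (fun w => f (X w) * conjc (f (Y w))) =
  cube_integral f * conjc (cube_integral f).
Proof.
move=> uX uY indep.
have mX : measurable_fun setT X by []; have mY : measurable_fun setT Y by [].
have mXY : measurable_fun setT (fun w => (X w, Y w)) by exact: measurable_fun_pair.
pose pX := distribution P X; pose pY := distribution P Y.
have gE (Z : {RV P >-> s.-tuple R}) : uniform_cube P Z -> (fun w => g (Z w)) = (fun w => f (Z w)).
  by move=> [cZ _]; apply/funext => w; rewrite on_cube_in.
have mg := cmeasurable_on_cube f_L2.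
have law (Z : {RV P >-> s.-tuple R}) : uniform_cube P Z ->
    cintegrable (distribution P Z) g /\ cint (distribution P Z) g = cube_integral f.
  move=> uZ; have mZ : measurable_fun setT Z by [].
  have PZ B : measurable B -> distribution P Z (setT `&` idfun @^-1` B) =
      ((1%:nng : {nonneg R})%:num%:E * P (setT `&` Z @^-1` B))%E.
    by move=> mB; rewrite !setTI mul1e.
  have iZ : cintegrable P (fun w => (w \in setT)%:R * g (Z w)).
    under eq_fun do rewrite in_setT mul1r; rewrite (gE _ uZ); exact: cintegrable_point.
  (* The transfer is used in reverse here: the law of [Z] is the target space with the identity, and
     [P] with [Z] is the source. *)
  have := cintegrable_transfer (@measurable_id _ _ setT) mZ measurableT measurableT PZ mg iZ.
  have := cint_transfer (@measurable_id _ _ setT) mZ measurableT measurableT PZ mg iZ.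
  have -> : (fun w => (w \in [set: s.-tuple R])%:R * g (idfun w)) = g.
    by apply/funext => w; rewrite in_setT mul1r.
  have -> : (fun w => (w \in [set: Omega])%:R * g (Z w)) = (fun w => f (Z w)).
    by rewrite -(gE _ uZ); apply/funext => w; rewrite in_setT mul1r.
  by rewrite cint_point // mul1r.
have [iX EX] := law X uX; have [iY EY] := law Y uY.
pose mixin := isMeasurableFun.Build _ _ _ _ _ mXY.
pose XY : {RV P >-> (s.-tuple R * s.-tuple R)%type} :=
  MeasurableFun.Pack (MeasurableFun.Class mixin).
have PXY B : measurable B -> P (setT `&` (fun w => (X w, Y w)) @^-1` B) =
    ((1%:nng : {nonneg R})%:num%:E * (pX \x pY) (setT `&` idfun @^-1` B))%E.
  move=> mB; rewrite !setTI mul1e.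
  by rewrite (product_measure_unique (m' := distribution P XY)).
have iG : cintegrable (pX \x pY)%E (fun z => g z.1 * conjc (g z.2)).
  by apply: (cintegrable_prod (G := fun y => conjc (g y))) => //; exact: cintegrable_conj.
have iG' : cintegrable (pX \x pY)%E (fun z => (z \in setT)%:R * (g z.1 * conjc (g z.2))).
  by under eq_fun do rewrite in_setT mul1r.
have := cint_transfer mXY (@measurable_id _ _ setT) measurableT measurableT PXY
  (cintegrable_measurable iG) iG'.
have -> : (fun w => (w \in [set: Omega])%:R * (g (X w, Y w).1 * conjc (g (X w, Y w).2))) =
    (fun w => f (X w) * conjc (f (Y w))).
  apply/funext => w; rewrite in_setT mul1r /=.
  by case: uX => cX _; case: uY => cY _; rewrite !on_cube_in.
move=> ->; rewrite /= mul1r.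
have -> : (fun z => (z \in setT)%:R * (g z.1 * conjc (g z.2))) =
    (fun z : s.-tuple R * s.-tuple R => g z.1 * conjc (g z.2)).
  by apply/funext => z; rewrite in_setT mul1r.
rewrite (cint_prod (G := fun y => conjc (g y))) //; last exact: cintegrable_conj.
by rewrite cint_conj // EX EY.
Qed.

(** The expectation is the integral over D_i divided by the volume of D_i. The integral is the
    diagonal form evaluated on the Walsh coefficients of [f], and the hypothesis on sigma_k^2
    factors it over coordinates. *)
Lemma cint_point_mul_digit_set (b m : nat) (X Y : {RV P >-> s.-tuple R}) (i : {ffun 'I_s -> nat})
    (x alpha : R) : prime b ->
  uniform_cube P X -> uniform_cube P Y -> (forall j, (i j < m)%N) ->
  (forall k : {ffun 'I_s -> nat}, sigma2 b f k =
      ((b%:R - 1) / b%:R) ^+ #|[pred j | k j != 0%N]| * (b%:R * x) ^+ (\sum_j k j)%N * alpha) ->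
  uniform_on P (leb \x leb)%E (digit_set R b i) (fun w => (X w, Y w)) ->
  cint P (fun w => f (X w) * conjc (f (Y w))) =
  ((\prod_j pair_factor b x (i j)) * alpha)%:C%C.
Proof.
move=> b_prime uX uY im f_walsh uXY.
have mX : measurable_fun setT X by []; have mY : measurable_fun setT Y by [].
have mXY : measurable_fun setT (fun w => (X w, Y w)) by exact: measurable_fun_pair.
have mg := cmeasurable_on_cube f_L2; have ig := cintegrable_on_cube f_L2.
have mF : cmeasurable (fun z : s.-tuple R * s.-tuple R => g z.1 * conjc (g z.2)).
  apply: cmeasurableM; first exact: cmeasurable_comp mg.
  by apply: cmeasurable_conj; exact: cmeasurable_comp mg.
have -> : (fun w => f (X w) * conjc (f (Y w))) =
    (fun w => g (X w, Y w).1 * conjc (g (X w, Y w).2)).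
  apply/funext => w /=.
  by case: uX => cX _; case: uY => cY _; rewrite !on_cube_in.
rewrite (cint_uniform (@measurable_digit_set R b m s b_prime i im) (digit_set_fin R b_prime im) mXY uXY mF
  (cintegrable_digit_set b_prime im ig)).
rewrite (digit_set_volume R b_prime im) (cint_digit_set b_prime im ig).
rewrite (exact_prefix_form b_prime (fun c => cell_integral f c) im) -realcM; congr (_%:C%C).
rewrite (sum_by_num_digits b_prime (fun j => digit_weight R b (i j))
  (g := block_factor b x) (alpha := alpha)); last first.
  move=> k km; rewrite -prod_block_factor -f_walsh (sigma2E _ b_prime km).
  by apply: eq_bigr => l _; rewrite walsh_coefE.
rewrite [X in _ * (X * _)](eq_bigr _ (fun j _ => sum_digit_weight b_prime x (im j))).
(* The factors b^-i (1 - 1/b) multiply to the volume of D_i and cancel it. *)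
rewrite [X in _ * (X * _)]big_split /= !mulrA mulVf ?mul1r //.
have b1 : 1 < b%:R :> R by rewrite ltr1n prime_gt1.
apply/prodf_neq0 => j _; rewrite mulf_neq0 //.
  by rewrite invr_eq0 expf_neq0 // gt_eqF //; apply: lt_trans b1.
by rewrite subr_eq0 gt_eqF // invf_lt1 //; apply: lt_trans b1.
Qed.

End point_laws.

(** The block of k = 0 contains only the constant Walsh function. With the hypothesis at k = 0 this
    identifies |E f|^2 with alpha. *)
Lemma walsh_mean (R : realType) (b s : nat) (f : s.-tuple R -> R[i]) : (1 < b)%N ->
  sigma2 b f [ffun=> 0%N] = ComplexField.Normc.normc (cube_integral f) ^+ 2.
Proof.
move=> b1; rewrite /sigma2; have -> : walsh_block b [ffun=> 0%N] = [set [ffun=> 0%N] : {ffun 'I_s -> nat}].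
  apply/seteqP; split => [l hl|l -> j] /=; last by rewrite !ffunE expn0 divn_small.
  by apply/ffunP => j; have := hl j; rewrite !ffunE expn0 divn_small //=; case: (l j).
rewrite fsbig_set1 /walsh_coef; congr (ComplexField.Normc.normc (cube_integral _) ^+ 2).
apply/funext => x; rewrite /wal big1 ?conjc1 ?mulr1 // => j _.
by rewrite /wal1 ffunE big_ord0 expr0.
Qed.

(** * Expectation over a random pair of indices *)

Section random_indices.
Context (R : realType) (n s : nat) (d : measure_display) (Omega : measurableType d)
  (P : probability Omega R) (U : 'I_n -> {RV P >-> s.-tuple R}).
Variables I J : Omega -> 'I_n.
Hypothesis IJ : random_distinct_indices P (fun l => U l) I J.
(** A function of both points, so that one statement covers f(U_I), f(U_J) and their product.
    Measurability is required on the whole tuple because independence of (I, J) is stated for the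
    whole sample. *)
Variable F : s.-tuple R -> s.-tuple R -> R[i].
Hypothesis mF : forall i j, cmeasurable (fun t : n.-tuple (s.-tuple R) => F (tnth t i) (tnth t j)).
Hypothesis iF : forall i j, cintegrable P (fun w => F (U i w) (U j w)).

Definition index_weight (i j : 'I_n) : R := if i == j then 0 else (n * n.-1)%:R^-1.

Let weight_ge0 i j : 0 <= index_weight i j.
Proof. by rewrite /index_weight; case: ifP. Qed.

Let A i j : set Omega := [set w | I w = i /\ J w = j].

Let sample w : n.-tuple (s.-tuple R) := [tuple U l w | l < n].

Let measurable_sample : measurable_fun setT sample.
Proof.
apply/measurable_fun_tnthP => i; rewrite (_ : _ \o _ = U i) //.
by apply/funext => w; rewrite /= tnth_mktuple.
Qed.

Let PA i j B : measurable B -> P (A i j `&` sample @^-1` B) =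
  ((NngNum (weight_ge0 i j))%:num%:E * P (setT `&` sample @^-1` B))%E.
Proof.
case: IJ => _ PIJ indep mB; rewrite setTI.
by have := indep i j B mB; rewrite PIJ.
Qed.

(** The events (I, J) = (i, j) partition the space, and on each one the indices are fixed, so
    independence can act on every term. *)
Let decompose w : F (U (I w) w) (U (J w) w) =
  \sum_i \sum_j (w \in A i j)%:R * F (tnth (sample w) i) (tnth (sample w) j).
Proof.
rewrite (bigD1 (I w)) //= [X in _ + X]big1 ?addr0 => [|i iI]; last first.
  apply: big1 => j _; rewrite (_ : w \in A i j = false) ?mul0r //.
  by apply/negP => /set_mem[e _]; rewrite e eqxx in iI.
rewrite (bigD1 (J w)) //= [X in _ + X]big1 ?addr0 => [|j jJ]; last first.
  rewrite (_ : w \in A (I w) j = false) ?mul0r //.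
  by apply/negP => /set_mem[_ e]; rewrite e eqxx in jJ.
by rewrite mem_set // mul1r !tnth_mktuple.
Qed.

Let transfer i j : cintegrable P (fun w => (w \in A i j)%:R * F (tnth (sample w) i) (tnth (sample w) j)) /\
  cint P (fun w => (w \in A i j)%:R * F (tnth (sample w) i) (tnth (sample w) j)) =
  (index_weight i j)%:C%C * cint P (fun w => F (U i w) (U j w)).
Proof.
have mA : measurable (A i j) by case: IJ => + _ _; exact.
have E : (fun w => (w \in setT)%:R * F (tnth (sample w) i) (tnth (sample w) j)) =
    (fun w => F (U i w) (U j w)).
  by apply/funext => w; rewrite in_setT mul1r !tnth_mktuple.
have iF' : cintegrable P (fun w => (w \in setT)%:R * F (tnth (sample w) i) (tnth (sample w) j)).
  by rewrite E.
have := cint_transfer measurable_sample measurable_sample mA measurableT (@PA i j) (mF i j) iF'.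
rewrite E => ->; split => //.
exact: (cintegrable_transfer measurable_sample measurable_sample mA measurableT (@PA i j) (mF i j) iF').
Qed.

Lemma cintegrable_random_indices : cintegrable P (fun w => F (U (I w) w) (U (J w) w)).
Proof.
rewrite (funext decompose); apply: cintegrable_sum => i _; apply: cintegrable_sum => j _.
exact: (transfer i j).1.
Qed.

Lemma cint_random_indices : cint P (fun w => F (U (I w) w) (U (J w) w)) =
  \sum_i \sum_j (index_weight i j)%:C%C * cint P (fun w => F (U i w) (U j w)).
Proof.
rewrite (funext decompose) cint_sum => [|i _]; last first.
  by apply: cintegrable_sum => j _; exact: (transfer i j).1.
apply: eq_bigr => i _; rewrite cint_sum => [|j _]; last exact: (transfer i j).1.
by apply: eq_bigr => j _; rewrite (transfer i j).2.
Qed.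

End random_indices.

Lemma sum_index_weight (R : realType) (n : nat) : (1 < n)%N ->
  \sum_(i < n) \sum_(j < n) index_weight R i j = 1.
Proof.
move=> n1.
have E (i : 'I_n) : \sum_(j < n) index_weight R i j = n.-1%:R * (n * n.-1)%:R^-1.
  rewrite (bigD1 i) //= /index_weight eqxx add0r.
  rewrite (eq_bigr (fun=> (n * n.-1)%:R^-1)) => [|j /negPf ji]; last by rewrite eq_sym ji.
  by rewrite sumr_const cardC1 card_ord mulr_natl.
rewrite (eq_bigr _ (fun i _ => E i)) sumr_const card_ord -mulrnAl -mulr_natl -natrM mulfV //.
by rewrite pnatr_eq0 muln_eq0 negb_or -!lt0n; case: n n1 {E} => [|[]].
Qed.

Theorem theorem18 (R : realType) (b s m : nat)
    (b_prime : prime b) (s_ge1 : (1 <= s)%N) (m_ge1 : (1 <= m)%N)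
    (d : measure_display) (Omega : measurableType d) (P : probability Omega R)
    (U : 'I_(b ^ m) -> {RV P >-> s.-tuple R}) (U_net : scrambled_net U)
    (f : s.-tuple R -> R[i]) (f_L2 : square_integrable f)
    (x alpha : R) (x_ge0 : 0 <= x) (x_lt : x < 1 / b%:R) (alpha_gt0 : 0 < alpha)
    (f_walsh : forall k : {ffun 'I_s -> nat},
      sigma2 b f k =
      ((b%:R - 1) / b%:R) ^+ #|[pred j | k j != 0%N]|
        * (b%:R * x) ^+ (\sum_j k j)%N * alpha) :
  (forall I J : Omega -> 'I_(b ^ m),
     random_distinct_indices P (fun l => U l) I J ->
     ccovariance P (fun w => f (U (I w) w)) (fun w => f (U (J w) w)) <= 0) /\
  (forall (d' : measure_display) (Omega' : measurableType d')
     (P' : probability Omega' R) (X : 'I_(b ^ m) -> {RV P' >-> s.-tuple R}),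
     monte_carlo_points X ->
     (cvariance P (sample_mean f (fun l => U l))
        <= cvariance P' (sample_mean f (fun l => X l)))%E).
Proof.
have b1 := prime_gt1 b_prime.
have N1 : (1 < b ^ m)%N.
  by apply: (leq_trans b1); rewrite -{1}[b]expn1; exact: leq_pexp2l (ltnW b1) m_ge1.
have N0 : (0 < b ^ m)%N := ltnW N1.
case: U_net => V V_net [U_unif U_pair].
have x_le1 : x <= 1.
  by apply: le_trans (ltW x_lt) _; rewrite mul1r invf_le1 ?ler1n ?ltr0n ltnW.
have mean2 : cube_integral f * conjc (cube_integral f) = alpha%:C%C.
  rewrite mulc_conj -(walsh_mean f b1) f_walsh; congr (_%:C%C).
  rewrite (_ : #|_| = 0%N) ?big1 ?expr0 ?mul1r //; last by apply: eq_card0 => j; rewrite inE ffunE eqxx.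
  by move=> j _; rewrite ffunE.
have /choice[gam gamP] : forall p : 'I_(b ^ m) * 'I_(b ^ m), exists i : {ffun 'I_s -> nat},
    p.1 != p.2 -> forall t, (i t < m)%N /\ forall k, (k <= m)%N ->
      common_prefix b m k (net_digits V p.1 t) (net_digits V p.2 t) = (k <= i t)%N.
  (* The value 0 on the diagonal is a dummy; the property is only claimed for distinct indices. *)
  move=> [l l'] /=; have [->|ll'] := eqVneq l l'; first by exists [ffun=> 0%N].
  by have [i hi] := net_first_difference b_prime V_net ll'; exists i.
pose e l j := \prod_t pair_factor b x (gam (l, j) t).
have iU l := cintegrable_point f_L2 (U_unif l).
have iUU l j := cintegrable_point_mul f_L2 (U_unif l) (U_unif j).
have meanU l := cint_point f_L2 (U_unif l).
have EU l j : l != j ->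
    cint P (fun w => f (U l w) * conjc (f (U j w))) = (e l j * alpha)%:C%C.
  move=> lj; have gm t := (gamP (l, j) lj t).1.
  apply: (cint_point_mul_digit_set f_L2 b_prime _ _ gm f_walsh) => //.
  apply: U_pair => //; case: V_net => cV _.
  split => [||t]; [exact: cV|exact: cV|].
  have [/andP[vl _] /andP[vj _]] := (cV l t, cV j t).
  have [gt gP] := gamP (l, j) lj t.
  (* The prefix test holds at the chosen count and fails at its successor, which is still at most
     m. *)
  rewrite (@common_digits_prefix _ b m) //.
  by rewrite (gP _ (ltnW gt)) (gP _ gt) leqnn ltnn.
have e_le l : \sum_(j | j != l) e l j <= (b ^ m).-1%:R.
  apply: (sum_pair_factor_le b_prime V_net (gamma := fun l j => gam (l, j))) => // l1 l2 l12 t.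
  exact: (gamP (l1, l2)).
split=> [I J IJ|d' Omega' P' X [X_unif X_indep]].
  pose g := on_cube f.
  have mg := cmeasurable_on_cube f_L2.
  have mgt i : cmeasurable (fun t : (b ^ m).-tuple (s.-tuple R) => g (tnth t i)).
    by apply: cmeasurable_comp mg; exact: measurable_tnth.
  have gU l w : g (U l w) = f (U l w) by case: (U_unif l) => cU _; rewrite /g on_cube_in.
  (* Functions of one point are treated as functions of the pair, so that the marginals of I and J
     come from the same lemma as the mixed moment. *)
  pose F0 (u v : s.-tuple R) := g u; pose F1 (u v : s.-tuple R) := g v.
  pose F2 (u v : s.-tuple R) := g u * conjc (g v).
  have mF0 (i j : 'I_(b ^ m)) := mgt i.
  have mF1 (i j : 'I_(b ^ m)) := mgt j.
  have mF2 i j := cmeasurableM (mgt i) (cmeasurable_conj (mgt j)).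
  have iF0 (i j : 'I_(b ^ m)) : cintegrable P (fun w => F0 (U i w) (U j w)).
    by rewrite /F0 (funext (gU i)).
  have iF1 (i j : 'I_(b ^ m)) : cintegrable P (fun w => F1 (U i w) (U j w)).
    by rewrite /F1 (funext (gU j)).
  have gUU i j : (fun w => F2 (U i w) (U j w)) = (fun w => f (U i w) * conjc (f (U j w))).
    by apply/funext => w; rewrite /F2 !gU.
  have iF2 i j : cintegrable P (fun w => F2 (U i w) (U j w)) by rewrite gUU.
  have meanF (F : s.-tuple R -> s.-tuple R -> R[i]) :
      (forall i j, cmeasurable (fun t : (b ^ m).-tuple _ => F (tnth t i) (tnth t j))) ->
      (forall i j, cintegrable P (fun w => F (U i w) (U j w))) ->
      (forall i j, cint P (fun w => F (U i w) (U j w)) = cube_integral f) ->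
      cint P (fun w => F (U (I w) w) (U (J w) w)) = cube_integral f.
    move=> mF iF EF; rewrite (cint_random_indices IJ mF iF).
    rewrite -[RHS]mul1r -[1 in RHS]/(1%:C%C) -(sum_index_weight R N1) realc_sum mulr_suml.
    apply: eq_bigr => i _; rewrite realc_sum mulr_suml.
    by apply: eq_bigr => j _; rewrite EF.
  have E0 := meanF F0 mF0 iF0 (fun i j => etrans (congr1 (cint P) (funext (gU i))) (meanU i)).
  have E1 := meanF F1 mF1 iF1 (fun i j => etrans (congr1 (cint P) (funext (gU j))) (meanU j)).
  have i0 := cintegrable_random_indices IJ mF0 iF0.
  have i1 := cintegrable_random_indices IJ mF1 iF1.
  have i2 := cintegrable_random_indices IJ mF2 iF2.
  have E2 := cint_random_indices IJ mF2 iF2.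
  have -> : (fun w => f (U (I w) w)) = (fun w => F0 (U (I w) w) (U (J w) w)).
    by apply/funext => w; rewrite /F0 gU.
  have -> : (fun w => f (U (J w) w)) = (fun w => F1 (U (I w) w) (U (J w) w)).
    by apply/funext => w; rewrite /F1 gU.
  rewrite ccovarianceE // [X in X - _]E2 E0 E1 mean2.
  have -> : \sum_i \sum_j (index_weight R i j)%:C%C * cint P (fun w => F2 (U i w) (U j w)) =
      (\sum_i \sum_j index_weight R i j * (e i j * alpha))%:C%C.
    rewrite realc_sum; apply: eq_bigr => i _; rewrite realc_sum; apply: eq_bigr => j _.
    rewrite gUU realcM; have [<-|ij] := eqVneq i j; last by rewrite EU.
    by rewrite /index_weight eqxx !mul0r.
  (* The covariance is real. [alpha] is written as alpha times the total weight 1, and the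
     comparison is made row by row: off the diagonal the weight is a constant, so [e_le] applies. *)
  rewrite -realcB lecE eqxx subr_le0 -[leRHS]mul1r -(sum_index_weight R N1).
  rewrite mulr_suml; apply: ler_sum => i _.
  rewrite (bigD1 i) //= [X in _ <= X * _](bigD1 i) //= /index_weight eqxx mul0r !add0r.
  pose c : R := (b ^ m * (b ^ m).-1)%:R^-1.
  rewrite (eq_bigr (fun j => c * alpha * e i j)) => [|j /negPf ji]; last first.
    by rewrite eq_sym ji -/c mulrA mulrAC.
  rewrite [X in _ <= X * _](eq_bigr (fun=> c)) => [|j /negPf ji]; last by rewrite eq_sym ji.
  rewrite -mulr_sumr sumr_const cardC1 card_ord -[c *+ _]mulr_natr [leRHS]mulrAC.
  by apply: ler_wpM2l => //; rewrite mulr_ge0 ?invr_ge0 // ltW.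
have iX l := cintegrable_point f_L2 (X_unif l).
have iXX l j := cintegrable_point_mul f_L2 (X_unif l) (X_unif j).
have meanX l := cint_point f_L2 (X_unif l).
have EX l j : l != j -> cint P' (fun w => f (X l w) * conjc (f (X j w))) = alpha%:C%C.
  move=> lj; rewrite -mean2; apply: cint_point_mul_indep => // A B mA mB.
  (* Independence of the family is applied to the index set {l, j}; the values of [C] at other
     indices are irrelevant. *)
  pose C k := if k == l then A else B.
  have mC k : measurable (C k) by rewrite /C; case: ifP.
  have jl : (j == l) = false by rewrite eq_sym (negPf lj).
  have := X_indep [set l; j]%SET C mC.
  rewrite big_setU1 ?inE //= big_set1 /C eqxx jl => <-; congr (P' _).
  apply/seteqP; split => w /= => [[Aw Bw] k|h]; last first.
    split; first by have := h l; rewrite !inE eqxx => /(_ isT).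
    by have := h j; rewrite !inE eqxx orbT jl => /(_ isT).
  by rewrite !inE => /orP[/eqP ->|/eqP ->]; rewrite ?eqxx ?jl.
rewrite (cvariance_sample_mean N0 iU iUU meanU) (cvariance_sample_mean N0 iX iXX meanX).
rewrite lee_fin lerB // ler_wpM2l ?invr_ge0 ?exprn_ge0 //.
pose vU l j := complex.Re (cint P (fun w => f (U l w) * conjc (f (U j w)))).
pose vX l j := complex.Re (cint P' (fun w => f (X l w) * conjc (f (X j w)))).
apply: ler_sum => l _; rewrite -[leLHS]/(\sum_j vU l j) -[leRHS]/(\sum_j vX l j).
(* The diagonal terms are equal. What remains of row l is alpha times a sum of at most N - 1 on the
   net side, and N - 1 times alpha for Monte Carlo. *)
rewrite (bigD1 l) //= [leRHS](bigD1 l) //= /vU /vX.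
rewrite (cint_point_square f_L2 (U_unif l)) (cint_point_square f_L2 (X_unif l)) lerD2l.
rewrite (eq_bigr (fun j => e l j * alpha)) => [|j jl]; last by rewrite EU // eq_sym.
rewrite [leRHS](eq_bigr (fun=> alpha)) => [|j jl]; last by rewrite EX // eq_sym.
rewrite -mulr_suml sumr_const cardC1 card_ord -[alpha *+ _]mulr_natl.
by apply: ler_wpM2r => //; exact: ltW.
Qed.
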